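(* Let $\lambda_1,\lambda_2>0$, $\alpha_1<\lambda_1+1$ and $\alpha_2<\lambda_2+1$. If $f_1\in\mathcal T_{\lambda_1,\alpha_1}$ and $f_2\in\mathcal T_{\lambda_2,\alpha_2}$, then the function $(f_1-f_1(0))(f_2-f_2(0))$ belongs to $\mathcal T_{\lambda_1+\lambda_2,\;\alpha_1+\alpha_2-1}$.
   Context: A function $g:(0,\infty)\to\mathbb R$ is completely monotonic if it is infinitely often differentiable and $(-1)^n g^{(n)}(x)\ge 0$ for all $n=0,1,2,\ldots$ and all $x>0$. A function $\varphi:(0,\infty)\to\mathbb R$ is completely monotonic of order $\alpha\in\mathbb R$ if $t\mapsto t^{\alpha}\varphi(t)$ is completely monotonic. For $\lambda>0$ the incomplete Gamma function is $\gamma(\lambda,x)=\int_0^x t^{\lambda-1}e^{-t}\,dt$. For $\lambda>0$ and $\alpha<\lambda+1$, the class $\mathcal T_{\lambda,\alpha}$ of higher order Thorin-Bernstein functions consists of all functions $f$ on $(0,\infty)$ that can be written as $$f(x)=A x^{\lambda}+B+\int_0^\infty \gamma(\lambda,xt)\varphi(t)\,dt,\quad x>0,$$ where $A,B\ge 0$ and $\varphi$ is completely monotonic of order $\alpha$ such that the integral converges for all $x>0$ (the zero function, with $A=B=0$ and $\varphi=0$, is included). For such $f$, $f(0)$ denotes $\lim_{x\to0^+}f(x)$ (which exists). *)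

(* Defs.v *)
From mathcomp Require Import all_boot all_order all_algebra.
From mathcomp Require Import all_classical all_reals all_analysis.

Set Implicit Arguments.
Unset Strict Implicit.
Unset Printing Implicit Defensive.

Import Order.TTheory GRing.Theory Num.Theory.
Import numFieldNormedType.Exports.

Local Open Scope classical_set_scope.
Local Open Scope ring_scope.

(* A function on (0, +oo) is represented by a total function on R; every
   definition below depends only on its values at positive arguments (the
   iterated derivatives at x > 0 depend only on the germ at x). *)

Definition completely_monotonic (R : realType) (g : R -> R) : Prop :=
  forall (n : nat) (x : R), 0 < x ->
    derivable (derive1n n g) x 1 /\ 0 <= (-1) ^+ n * derive1n n g x.

Definition completely_monotonic_order (R : realType) (alpha : R)
    (phi : R -> R) : Prop :=
  completely_monotonic (fun t : R => t `^ alpha * phi t).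

Definition incomplete_gamma (R : realType) (lambda x : R) : R :=
  (\int[@lebesgue_measure R]_(t in `]0, x]) (t `^ (lambda - 1) * expR (- t)))%R.

(* phi and the incomplete Gamma function are nonnegative on (0, +oo), so
   convergence of the integral is Lebesgue integrability of the integrand. *)
Definition thorin_bernstein (R : realType) (lambda alpha : R) (f : R -> R) :
    Prop :=
  exists (A B : R) (phi : R -> R),
    [/\ 0 <= A, 0 <= B, completely_monotonic_order alpha phi,
        forall x : R, 0 < x ->
          (@lebesgue_measure R).-integrable `]0, +oo[
            (fun t : R => (incomplete_gamma lambda (x * t) * phi t)%:E)
      & forall x : R, 0 < x ->
          f x = A * x `^ lambda + B +
            (\int[@lebesgue_measure R]_(t in `]0%R, +oo[)
               (incomplete_gamma lambda (x * t) * phi t))%R].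

Definition value_at0 (R : realType) (f : R -> R) : R :=
  lim (f x @[x --> 0^'+]).

(* Main.v *)
Require Import Defs.
From mathcomp Require Import all_boot all_order all_algebra.
From mathcomp Require Import all_classical all_reals all_analysis.
From mathcomp Require Import measurable_realfun ring lra.

Set Implicit Arguments.
Unset Strict Implicit.
Unset Printing Implicit Defensive.

Import Order.TTheory GRing.Theory Num.Theory.
Import numFieldNormedType.Exports.

Local Open Scope classical_set_scope.
Local Open Scope ring_scope.

(**
Fix [x > 0] and let [Phi(s)] be the integral of [phi] over [[s, +oo)].  Rescaling
the incomplete Gamma function and exchanging the integrals gives
  [int_0^oo gamma(l, x t) phi(t) dt = x^l int_0^oo e^(-x s) s^(l-1) Phi(s) ds],
so that [f - f(0) = x^l (A + L)], where [L] is the Laplace transform of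
[s^(l-1) Phi(s)] ([hintegral_gamma], [density_of_thorin_bernstein]).  The
product of two such functions is [x^(l1+l2)] times
  [A1 A2 + A1 L2 + A2 L1 + L1 L2],
and each of the last three terms has to be recognized as a transform of the same
kind for the exponent [l1 + l2], with a density of order
[alpha1 + alpha2 - 1].

Two facts do the work.  A product of tails is the tail of [a B + b A], where [A]
and [B] are the tails of [a] and [b] ([tailM]); this is integration by parts, but
it follows from Tonelli alone.  And if [a] has order [alpha], then its tail has
order [alpha - 1], because after rescaling the tail is a superposition of
dilations of one completely monotonic function ([cm_tail]); hence [a B + b A]
has order [alpha + beta - 1] ([cm_density_product]).

For [A1 L2], note that [t^(-l1)] is the tail of [l1 t^(-l1-1)], which has order
[alpha1] exactly when [alpha1 <= l1 + 1]; so [t^(-l1) Phi2(t)] is a product of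
tails ([laplace_powR]).  For [L1 L2], the convolution theorem, with the two
arguments of the convolution written as fixed shares of their sum, represents the
tail sought as a superposition, over the shares, of products of dilated tails
[Phi1(p t) Phi2(q t)] ([laplace_convolution]).  Complete monotonicity survives
superposition ([cm_integral]): the derivative of a completely monotonic function
at [t] is at most [(2 / t) g (t / 2)] in absolute value, which is the domination needed to
differentiate under the integral sign.

Densities and tails take values in the extended reals, so that Tonelli applies
without conditions.  Finiteness is recovered afterwards from monotonicity: a
nonincreasing function with a finite weighted integral is finite
([nonincreasing_lty]).
*)

(** * Completely monotonic functions *)

Section completely_monotonic.
Context {R : realType}.
Implicit Types (g h : R -> R) (P : (R -> R) -> Prop).

Lemma near_gt0 (x : R) : 0 < x -> \forall y \near x, 0 < y.
Proof. by move=> x0; exact: lt_nbhsr. Qed.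

(** Since [completely_monotonic] speaks of all derivatives at once, closure
properties are proved by coinduction: a class stable under [g |-> - g'] and made
of nonnegative functions consists of completely monotonic ones. *)
Lemma cm_coind P :
  (forall g, P g -> exists2 h, P h &
     forall x, 0 < x -> 0 <= g x /\ is_derive x 1 g (- h x)) ->
  forall g, P g -> completely_monotonic g.
Proof.
move=> Pstep g Pg n x x0.
have [h Ph gh] : exists2 h, P h &
    forall y, 0 < y -> derive1n n g y = (-1) ^+ n * h y.
  elim: n => [|n [h Ph IH]]; first by exists g => // y _; rewrite mul1r.
  have [k Pk hk] := Pstep _ Ph; exists k => // y y0.
  rewrite derive1nS derive1E (near_eq_derive (g := (-1) ^+ n \*o h)).
    have [_ dh] := hk _ y0; rewrite derive_val.
    by rewrite exprS mulN1r mulNr; exact: mulrN.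
  by near do rewrite IH//; exact: near_gt0.
have [k Pk hk] := Pstep _ Ph; have [h0 dh] := hk _ x0; split.
  apply: (@near_eq_derivable _ _ _ ((-1) ^+ n \*o h)).
    by near do rewrite gh//; exact: near_gt0.
  exact: ex_derive.
by rewrite gh// mulrA -exprMn mulrNN mul1r expr1n mul1r.
Unshelve. all: end_near. Qed.

Definition opp_derive g : R -> R := fun x => - derive1 g x.

Lemma cm_ge0 g (x : R) : completely_monotonic g -> 0 < x -> 0 <= g x.
Proof. by move=> /(_ 0%N x) cg /cg[_]; rewrite mul1r. Qed.

Lemma cm_derive g (x : R) : completely_monotonic g -> 0 < x ->
  is_derive x 1 g (- opp_derive g x).
Proof.
move=> /(_ 0%N x) cg /cg[dg _].
by rewrite /opp_derive opprK derive1E; exact: DeriveDef.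
Qed.

(** Only the values on the positive half-line matter; this lets [cm_eq] and
[cm_opp_derive] be read off as the cases [n = 0] and [n = 1]. *)
Lemma cm_signed_derive g h n :
  (forall x, 0 < x -> h x = (-1) ^+ n * derive1n n g x) ->
  completely_monotonic g -> completely_monotonic h.
Proof.
move=> hg cg.
pose P k := exists n, forall x, 0 < x -> k x = (-1) ^+ n * derive1n n g x.
apply: (@cm_coind P); last by exists n.
move=> {n hg h} k [n kE]; exists (fun x => (-1) ^+ n.+1 * derive1n n.+1 g x).
  by exists n.+1.
move=> x x0; have [dg g0] := cg n x x0; split; first by rewrite kE.
apply: (@near_eq_is_derive _ _ _ ((-1) ^+ n \*o derive1n n g)).
  by near do rewrite /= kE//; exact: near_gt0.
rewrite derive1nS derive1E; apply: is_derive_eq.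
  exact: (is_deriveZ _ (DeriveDef dg erefl)).
by rewrite exprS mulN1r mulNr opprK.
Unshelve. all: end_near. Qed.

Lemma cm_eq g h : (forall x, 0 < x -> g x = h x) ->
  completely_monotonic g -> completely_monotonic h.
Proof.
by move=> gh; apply: (@cm_signed_derive _ _ 0%N) => x x0; rewrite mul1r -gh.
Qed.

Lemma cm_opp_derive g :
  completely_monotonic g -> completely_monotonic (opp_derive g).
Proof.
by apply: (@cm_signed_derive _ _ 1%N) => x x0; rewrite expr1 mulN1r.
Qed.

Lemma cm_continuous g (x : R) : completely_monotonic g -> 0 < x ->
  {for x, continuous g}.
Proof.
move=> cg x0; apply/differentiable_continuous/derivable1_diffP.
by have [] := cm_derive cg x0.
Qed.

Lemma cm_MVT g (a b : R) : completely_monotonic g -> 0 < a -> a < b ->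
  exists2 c, a < c < b & g a - g b = opp_derive g c * (b - a).
Proof.
move=> cg a0 ab; have [|x|c] := @MVT _ g (fun x => - opp_derive g x) _ _ ab.
- by move=> x /itvP xab; apply: cm_derive => //; rewrite (lt_trans a0) ?xab.
- apply: derivable_within_continuous => y /itvP yab.
  by have [] := cm_derive cg (lt_le_trans a0 (_ : a <= y)); rewrite ?yab.
move=> /itvP cab gE; exists c; first by rewrite !cab.
by rewrite -opprB gE mulNr opprK.
Qed.

Lemma cm_nonincreasing g (a b : R) : completely_monotonic g -> 0 < a -> a <= b ->
  g b <= g a.
Proof.
move=> cg a0; rewrite le_eqVlt => /predU1P[->//|ab].
have [c /andP[ac _] gE] := cm_MVT cg a0 ab.
rewrite -subr_ge0 gE mulr_ge0 ?subr_ge0 ?(ltW ab)//.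
exact: cm_ge0 (cm_opp_derive cg) (lt_trans a0 ac).
Qed.

(** By the mean value theorem [g (a / 2) - g a] is [a / 2] times a value of
[- g'] to the left of [a], and [- g'] is nonincreasing.  The bound involves only
the values of [g], so an integrable family has integrable derivatives. *)
Lemma cm_opp_derive_le g (a : R) : completely_monotonic g -> 0 < a ->
  opp_derive g a <= (a / 2)^-1 * g (a / 2).
Proof.
move=> cg a0; have a20 : 0 < a / 2 by rewrite divr_gt0.
rewrite mulrC ler_pdivlMr//.
have [|c /andP[ac ca] gE] := cm_MVT cg a20 (_ : a / 2 < a); first by lra.
have aE : a / 2 = a - a / 2 by lra.
rewrite [X in _ * X <= _]aE.
apply: (@le_trans _ _ (opp_derive g c * (a - a / 2))).
  rewrite ler_wpM2r//; first by lra.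
  exact: cm_nonincreasing (cm_opp_derive cg) (lt_trans a20 ac) (ltW ca).
by rewrite -gE gerBl cm_ge0.
Qed.

Lemma cm_powR (b : R) : 0 <= b -> completely_monotonic (fun t => t `^ (- b)).
Proof.
move=> b0.
pose P k := exists c b : R, [/\ 0 <= c, 0 <= b &
  forall x, 0 < x -> k x = c * x `^ (- b)].
apply: (@cm_coind P); last by exists 1, b; split=> // x _; rewrite mul1r.
move=> k [c [{}b [c0 {}b0 kE]]].
exists (fun x => (c * b) * x `^ (- (b + 1))).
  by exists (c * b), (b + 1); split; rewrite ?mulr_ge0 ?addr_ge0.
move=> x x0; split; first by rewrite kE// mulr_ge0 ?powR_ge0.
apply: (@near_eq_is_derive _ _ _ (c \*o (fun y : R => y `^ (- b)))).
  by near do rewrite /= kE//; exact: near_gt0.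
apply: is_derive_eq; first exact: (is_deriveZ _ (is_derive1_powR _ x0)).
by rewrite /GRing.scale/= opprD; ring.
Unshelve. all: end_near. Qed.

Lemma cm_dilate g (c p : R) : 0 <= c -> 0 < p -> completely_monotonic g ->
  completely_monotonic (fun t => c * g (p * t)).
Proof.
move=> c0 p0 cg.
pose P k := exists c g, [/\ 0 <= c, completely_monotonic g &
  forall x, 0 < x -> k x = c * g (p * x)].
apply: (@cm_coind P); last by exists c, g; split.
move=> k [{}c [{}g [{}c0 {}cg kE]]].
exists (fun x => (c * p) * opp_derive g (p * x)).
  exists (c * p), (opp_derive g); split=> //; last exact: cm_opp_derive.
  by rewrite mulr_ge0// ltW.
move=> x x0; have px0 := mulr_gt0 p0 x0.
split; first by rewrite kE// mulr_ge0 ?(cm_ge0 cg).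
apply: (@near_eq_is_derive _ _ _ (c \*o (g \o ( *%R p)))).
  by near do rewrite /= kE//; exact: near_gt0.
have dp : is_derive x 1 ( *%R p) p.
  by apply: is_derive_eq; rewrite /GRing.scale/= mulr1.
apply: is_derive_eq.
  apply: is_deriveZ; exact: (is_derive1_comp (cm_derive cg px0) dp).
by rewrite /GRing.scale/=; ring.
Unshelve. all: end_near. Qed.

(** Differentiating a product gives a sum of two products: sums of products are
the smallest class to which coinduction applies. *)
Inductive cm_sum : (R -> R) -> Prop :=
| cm_sum_mul g h k : completely_monotonic g -> completely_monotonic h ->
    (forall x, 0 < x -> k x = g x * h x) -> cm_sum k
| cm_sum_add g h k : cm_sum g -> cm_sum h ->
    (forall x, 0 < x -> k x = g x + h x) -> cm_sum k.

Lemma cm_sumP g : cm_sum g -> completely_monotonic g.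
Proof.
apply: cm_coind => {g} k; elim=> {k}
  [g h k cg ch kE|g h k _ [g' cg' dg] _ [h' ch' dh] kE].
- exists (fun x => opp_derive g x * h x + g x * opp_derive h x).
    apply: (@cm_sum_add (opp_derive g \* h) (g \* opp_derive h)) => //.
    + exact: (cm_sum_mul (cm_opp_derive cg) ch).
    + exact: (cm_sum_mul cg (cm_opp_derive ch)).
  move=> x x0; split; first by rewrite kE// mulr_ge0 ?(cm_ge0 cg) ?(cm_ge0 ch).
  apply: (@near_eq_is_derive _ _ _ (g * h)).
    by near do rewrite kE//; exact: near_gt0.
  apply: is_derive_eq; first exact: is_deriveM (cm_derive cg x0) (cm_derive ch x0).
  by rewrite /GRing.scale/=; ring.
- exists (fun x => g' x + h' x); first exact: (cm_sum_add cg' ch').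
  move=> x x0; have [g0 {}dg] := dg x x0; have [h0 {}dh] := dh x x0.
  split; first by rewrite kE// addr_ge0.
  apply: (@near_eq_is_derive _ _ _ (g + h)).
    by near do rewrite kE//; exact: near_gt0.
  by apply: is_derive_eq; rewrite opprD.
Unshelve. all: end_near. Qed.

Lemma cm_cst (c : R) : 0 <= c -> completely_monotonic (fun=> c).
Proof.
move=> c0; apply: (@cm_eq (fun t => c * (1 * t) `^ (- 0))).
  by move=> x _; rewrite oppr0 powRr0 mulr1.
exact: (cm_dilate c0 ltr01 (cm_powR (lexx 0))).
Qed.

Lemma cmM g h : completely_monotonic g -> completely_monotonic h ->
  completely_monotonic (g \* h).
Proof. by move=> cg ch; apply/cm_sumP; exact: (cm_sum_mul cg ch). Qed.

Lemma cmD g h : completely_monotonic g -> completely_monotonic h ->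
  completely_monotonic (g \+ h).
Proof.
have cs k : completely_monotonic k -> cm_sum k.
  by move=> ck; apply: (cm_sum_mul ck (cm_cst ler01)) => x _; rewrite mulr1.
by move=> /cs cg /cs ch; apply/cm_sumP; exact: (cm_sum_add cg ch).
Qed.

(** Coinduction on superpositions of completely monotonic functions; the
derivative is taken under the integral sign thanks to [cm_opp_derive_le]. *)
Lemma cm_integral d (T : measurableType d) (mu : {measure set T -> \bar R})
    (D : set T) (h : T -> R -> R) : measurable D ->
  (forall v, D v -> completely_monotonic (h v)) ->
  (forall t : R, 0 < t -> mu.-integrable D (fun v => (h v t)%:E)) ->
  completely_monotonic (fun t : R => \int[mu]_(v in D) h v t).
Proof.
move=> mD ch ih.
pose P k := exists h : T -> R -> R,
  [/\ forall v, D v -> completely_monotonic (h v),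
     forall t : R, 0 < t -> mu.-integrable D (fun v => (h v t)%:E) &
     forall t : R, 0 < t -> k t = \int[mu]_(v in D) h v t].
apply: (@cm_coind P); last by exists h.
move=> k {ch ih}[{}h [ch ih kE]].
(* On ]t / 2, 2 t[ the derivative is at most its value at t / 2 in absolute
   value, hence at most (t / 4)^-1 h(t / 4). *)
have dom (t : R) v x : 0 < t -> D v -> x \in `]t / 2, 2 * t[ ->
    `|derive1 (h v) x| <= `|(t / 2 / 2)^-1 * h v (t / 2 / 2)|.
  move=> t0 Dv; rewrite in_itv/= => /andP[tx _].
  have t20 : 0 < t / 2 by rewrite divr_gt0.
  have x0 := lt_trans t20 tx.
  have -> : derive1 (h v) x = - opp_derive (h v) x by rewrite /opp_derive opprK.
  rewrite normrN ger0_norm; last exact: (cm_ge0 (cm_opp_derive (ch _ Dv))).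
  apply/(le_trans _ (ler_norm _))/(le_trans _ (cm_opp_derive_le (ch _ Dv) t20)).
  exact: cm_nonincreasing (cm_opp_derive (ch _ Dv)) t20 (ltW tx).
have itv_t (t : R) : 0 < t -> t \in `]t / 2, 2 * t[ by move=> t0; rewrite in_itv/=; lra.
have itv0 (t x : R) : 0 < t -> x \in `]t / 2, 2 * t[ -> 0 < x.
  by move=> t0; rewrite in_itv/=; lra.
have idom (t : R) : 0 < t ->
    mu.-integrable D (fun v => `|(t / 2 / 2)^-1 * h v (t / 2 / 2)|%:E).
  move=> t0; apply: (@integrable_norm _ _ _ mu D
    (fun v => (t / 2 / 2)^-1 * h v (t / 2 / 2))).
  rewrite /comp; under eq_fun do rewrite EFinM.
  by apply: integrableZl => //; apply: ih; rewrite !divr_gt0.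
have id (t : R) : 0 < t -> mu.-integrable D (fun v => (opp_derive (h v) t)%:E).
  move=> t0; apply: le_integrable (idom t t0) => //; last first.
    by move=> v Dv; rewrite /= lee_fin normrN normr_id dom// itv_t.
  (* Measurability in v: the derivative is a limit of difference quotients. *)
  pose q n v := (h v (t + n.+1%:R^-1) - h v t) * n.+1%:R.
  have mh (s : R) : 0 < s -> measurable_fun D (fun v => h v s).
    by move=> s0; apply/measurable_EFinP/measurable_int/ih.
  apply/measurable_EFinP/(@measurable_fun_cvg _ _ _ D (fun n v => - q n v)).
    move=> n; apply: measurableT_comp => //; apply: measurable_funM => //.
    by apply: measurable_funB; apply: mh => //; rewrite addr_gt0.
  move=> v Dv; apply: cvgN.
  have /cvg_ex[l hl] : derivable (h v) t 1 by have [] := cm_derive (ch _ Dv) t0.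
  have -> : derive1 (h v) t = l.
    by apply/cvg_lim => //; move: hl; under eq_fun do rewrite scaler1.
  move/cvgr_dnbhsP : hl => /(_ (fun n => n.+1%:R^-1)) hl.
  have -> : q^~ v = fun n : nat =>
      (n.+1%:R^-1)^-1 *: ((h v \o shift t) (n.+1%:R^-1 *: 1) - h v t).
    by apply/funext => n; rewrite /q /= scaler1 invrK [t + _]addrC mulrC.
  by apply: hl; split=> [n|]; [rewrite invr_eq0|exact: cvg_harmonic].
exists (fun t : R => \int[mu]_(v in D) opp_derive (h v) t).
  exists (fun v => opp_derive (h v)); split=> // v Dv.
  exact/cm_opp_derive/ch.
move=> t t0; split.
  by rewrite kE//; apply: Rintegral_ge0 => v Dv; exact: (cm_ge0 (ch _ Dv)).
pose f (x : R) v := h v x.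
apply: (@near_eq_is_derive _ _ _ (fun t : R => \int[mu]_(v in D) f t v)).
  by near do rewrite kE//; exact: near_gt0.
have intf x : `]t / 2, 2 * t[%classic x -> mu.-integrable D (EFin \o f x).
  by move=> /(itv0 _ _ t0); exact: ih.
have derf1 x y : `]t / 2, 2 * t[%classic x -> D y -> derivable (f ^~ y) x 1.
  by move=> /(itv0 _ _ t0) x0 Dy; have [] := cm_derive (ch _ Dy) x0.
have ub x y : `]t / 2, 2 * t[%classic x -> D y ->
    `|partial1of2 f x y| <= `|(t / 2 / 2)^-1 * h y (t / 2 / 2)|.
  by move=> xt Dy; exact: dom.
apply: DeriveDef.
  exact: (derivable_under_integral mD (itv_t t t0) intf derf1
    (fun=> normr_ge0 _) (idom t t0) ub).
rewrite -derive1E.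
rewrite (differentiation_under_integral mD (itv_t t t0) intf derf1
  (fun=> normr_ge0 _) (idom t t0) ub).
rewrite -mulN1r -RintegralZl//; last exact: id.
by apply: eq_Rintegral => v _; rewrite /opp_derive mulN1r opprK.
Unshelve. all: end_near. Qed.

End completely_monotonic.

(** * Integrals over the half-line *)

Section half_line_integral.
Context {R : realType}.
Local Open Scope ereal_scope.
Local Notation mu := (@lebesgue_measure R).
Implicit Types (f g : R -> \bar R) (F : R -> R -> \bar R).

Definition hintegral f := \int[mu]_(t in `]0%R, +oo[) f t.

Lemma in_half (t : R) : (`]0%R, +oo[%classic : set R) t <-> (0 < t)%R.
Proof. by rewrite /= in_itv/= andbT. Qed.

Lemma eq_hintegral f g : (forall t, (0 < t)%R -> f t = g t) -> hintegral f = hintegral g.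
Proof. by move=> fg; apply: eq_integral => t /[!inE] /in_half/fg. Qed.

Lemma hintegral_ge0 f : (forall t, (0 < t)%R -> 0 <= f t) -> 0 <= hintegral f.
Proof. by move=> f0; apply: integral_ge0 => t /in_half/f0. Qed.

Lemma le_hintegral f g : measurable_fun [set: R] f -> measurable_fun [set: R] g ->
  (forall t, 0 <= f t) -> (forall t, (0 < t)%R -> f t <= g t) ->
  hintegral f <= hintegral g.
Proof.
move=> mf mg f0 fg; apply: ge0_le_integral => //.
- exact: measurable_funTS.
- exact: measurable_funTS.
- by move=> t /in_half/fg.
Qed.

Lemma hintegralZ (c : \bar R) f : measurable_fun [set: R] f ->
  (forall t, 0 <= f t) -> 0 <= c -> hintegral (fun t => c * f t) = c * hintegral f.
Proof.
by move=> mf f0 c0; rewrite /hintegral ge0_integralZl//; exact: measurable_funTS.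
Qed.

Lemma hintegralD f g : measurable_fun [set: R] f -> measurable_fun [set: R] g ->
  (forall t, 0 <= f t) -> (forall t, 0 <= g t) ->
  hintegral (fun t => f t + g t) = hintegral f + hintegral g.
Proof.
by move=> mf mg f0 g0; rewrite /hintegral ge0_integralD//; exact: measurable_funTS.
Qed.

Let hintegralE f : hintegral f = \int[mu]_t (f t * (\1_(`]0%R, +oo[ : set R) t)%:E).
Proof. by rewrite /hintegral integral_mkcond; under eq_integral do rewrite epatch_indic. Qed.

Section two_variables.
Variable F : R -> R -> \bar R.
Hypothesis mF : measurable_fun [set: R * R] (fun z => F z.1 z.2).
Hypothesis F0 : forall x y, 0 <= F x y.

Let ind (x : R) : R := \1_(`]0%R, +oo[ : set R) x.
Let mind : measurable_fun [set: R] ind.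
Proof. exact: measurable_indic. Qed.

Lemma measurable_hintegral : measurable_fun [set: R] (fun x => hintegral (F x)).
Proof.
under eq_fun do rewrite hintegralE.
pose h (z : R * R) := F z.1 z.2 * (ind z.2)%:E.
have := @measurable_fun_fubini_tonelli_F _ _ _ _ _ mu h.
rewrite /fubini_F; apply.
- apply: emeasurable_funM => //; apply/measurable_EFinP.
  exact: measurableT_comp mind measurable_snd.
- by move=> z; rewrite /h mule_ge0// lee_fin /ind indicE.
Qed.

Lemma hintegral_tonelli :
  hintegral (fun x => hintegral (F x)) = hintegral (fun y => hintegral (fun x => F x y)).
Proof.
pose h (z : R * R) := F z.1 z.2 * (ind z.1)%:E * (ind z.2)%:E.
have mh : measurable_fun setT h.
  apply: emeasurable_funM; first apply: emeasurable_funM => //.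
  - apply/measurable_EFinP; exact: measurableT_comp mind measurable_fst.
  - apply/measurable_EFinP; exact: measurableT_comp mind measurable_snd.
have h0 z : 0 <= h z by rewrite /h !mule_ge0// lee_fin /ind indicE.
have ind0 x : 0 <= (ind x)%:E by rewrite lee_fin /ind indicE.
have mFx x : measurable_fun [set: R] (F x).
  exact: (measurableT_comp mF (measurable_pair1 x)).
have mFy y : measurable_fun [set: R] (F^~ y).
  exact: (measurableT_comp mF (measurable_pair2 y)).
have mE : measurable_fun [set: R] (EFin \o ind) by exact/measurable_EFinP.
transitivity (\int[mu]_x \int[mu]_y h (x, y)).
  rewrite hintegralE; apply: eq_integral => x _; rewrite hintegralE muleC.
  rewrite -ge0_integralZl//; last 2 first.
  - exact: emeasurable_funM (mFx x) mE.
  - by move=> y _; exact: mule_ge0 (F0 _ _) (ind0 _).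
  by apply: eq_integral => y _; rewrite /h/= muleA (muleC _ (F x y)).
transitivity (\int[mu]_y \int[mu]_x h (x, y)).
  exact: (@fubini_tonelli _ _ _ _ _ mu mu h mh h0).
rewrite hintegralE; apply: eq_integral => y _.
rewrite hintegralE [RHS]muleC -ge0_integralZl//; last 2 first.
- exact: emeasurable_funM (mFy y) mE.
- by move=> x _; exact: mule_ge0 (F0 _ _) (ind0 _).
by apply: eq_integral => x _; rewrite /h/= muleC.
Qed.

End two_variables.

(** The image of Lebesgue measure under [x |-> c x], multiplied by [c], agrees with
Lebesgue measure on intervals. *)
Lemma hintegral_scale (c : R) f : (0 < c)%R -> measurable_fun [set: R] f ->
  (forall t, 0 <= f t) -> hintegral f = c%:E * hintegral (fun t => f (c * t)%R).
Proof.
move=> c0 mf f0.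
have mc : measurable_fun [set: R] ( *%R c : R -> measurableTypeR R).
  exact: mulrl_measurable.
pose cmu' : {measure set (measurableTypeR R) -> \bar R} :=
  mscale (NngNum (ltW c0)) (pushforward mu ( *%R c : R ->  measurableTypeR R)).
pose cmu := cmu' mc.
have cmuE A : measurable A -> mu A = cmu A.
  apply: lebesgue_measure_unique => //= _ [[a b]] _ <-.
  rewrite /mscale/= /pushforward/=.
  have -> : *%R c @^-1` `]a, b] = `](a / c)%R, (b / c)%R]%classic.
    apply/seteqP; split => x /=; rewrite !in_itv/=.
      by rewrite ltr_pdivrMr// ler_pdivlMr// ![(x * _)%R]mulrC.
    by rewrite ltr_pdivrMr// ler_pdivlMr// ![(x * _)%R]mulrC.
  rewrite !lebesgue_measure_itv/= !lte_fin ltr_pM2r ?invr_gt0//.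
  case: ifPn => _; last by rewrite mule0.
  by rewrite -!EFinD -EFinM -mulrBl mulrCA divff ?mulr1// gt_eqF.
rewrite /hintegral (@eq_measure_integral _ _ _ _ cmu); last by move=> A mA _; exact: cmuE.
rewrite ge0_integral_mscale//=; last exact: measurable_funTS.
congr (_ * _); rewrite ge0_integral_pushforward//=; last first.
  exact: measurable_funTS.
congr (integral _ _ _); apply/seteqP; split => x /=; rewrite !in_itv/= !andbT.
  by rewrite pmulr_rgt0.
by rewrite pmulr_rgt0.
Qed.

End half_line_integral.

(** * Tails *)

Section tail_integral.
Context {R : realType}.
Local Open Scope ereal_scope.
Implicit Types (f g a b : R -> \bar R) (s t : R).

(** Indicators of [s <= t] and [s < t]: a tail is written with an indicator rather
than as an integral over [[s, +oo)] so that Tonelli can exchange it with other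
integrals. *)
Definition above s t : \bar R := (s <= t)%R%:R%:E.
Definition below s t : \bar R := (s < t)%R%:R%:E.

Lemma above_ge0 s t : 0 <= above s t. Proof. by rewrite lee_fin. Qed.
Lemma below_ge0 s t : 0 <= below s t. Proof. by rewrite lee_fin. Qed.

Lemma measurable_indb d (T : measurableType d) (p : T -> bool) :
  measurable_fun setT p -> measurable_fun setT (fun z => (p z)%:R%:E : \bar R).
Proof.
move=> mp; apply/measurable_EFinP.
rewrite (_ : (fun _ => _) = fun z => if p z then 1%R else 0%R : R); last first.
  by apply/funext => z /=; case: (p z).
exact: measurable_fun_ifT.
Qed.

Lemma measurable_above d (T : measurableType d) (p q : T -> R) :
  measurable_fun setT p -> measurable_fun setT q ->
  measurable_fun setT (fun z => above (p z) (q z)).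
Proof. by move=> mp mq; apply: measurable_indb; exact: measurable_fun_ler. Qed.

Lemma measurable_below d (T : measurableType d) (p q : T -> R) :
  measurable_fun setT p -> measurable_fun setT q ->
  measurable_fun setT (fun z => below (p z) (q z)).
Proof. by move=> mp mq; apply: measurable_indb; exact: measurable_fun_ltr. Qed.

Definition tail f s := hintegral (fun t => above s t * f t).

Section tail_facts.
Variable f : R -> \bar R.
Hypothesis mf : measurable_fun [set: R] f.
Hypothesis f0 : forall t, 0 <= f t.

Lemma measurable_tail : measurable_fun [set: R] (tail f).
Proof.
apply: (@measurable_hintegral _ (fun s t => above s t * f t)) => [|x y].
  apply: emeasurable_funM; last exact: measurableT_comp mf measurable_snd.
  exact: measurable_above measurable_fst measurable_snd.
by rewrite mule_ge0// above_ge0.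
Qed.

Lemma measurable_above_mul s : measurable_fun [set: R] (fun t => above s t * f t).
Proof. by apply: emeasurable_funM => //; exact: measurable_above. Qed.

Lemma above_mul_ge0 s t : 0 <= above s t * f t.
Proof. by rewrite mule_ge0// above_ge0. Qed.

Lemma tail_ge0 s : 0 <= tail f s.
Proof. by apply: hintegral_ge0 => t _; exact: above_mul_ge0. Qed.

Lemma tail_nonincreasing s t : (s <= t)%R -> tail f t <= tail f s.
Proof.
move=> st; apply: le_hintegral => [|||r _].
- exact: measurable_above_mul.
- exact: measurable_above_mul.
- exact: above_mul_ge0.
- rewrite lee_wpmul2r// lee_fin ler_nat; case: (leP t r) => // tr.
  by rewrite (le_trans st tr).
Qed.

(** The two integrands differ only at the null set [{s}]. *)
Lemma hintegral_below s : hintegral (fun t => below s t * f t) = tail f s.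
Proof.
have mD : measurable (`]0%R, +oo[%classic `\ s : set R) by exact: measurableD.
rewrite /tail /hintegral -[LHS](@integral_setD1 _ _ s)//; last first.
  apply: measurable_funTS; apply: emeasurable_funM => //.
  exact: measurable_below.
rewrite -[RHS](@integral_setD1 _ _ s)//; last first.
  by apply: measurable_funTS; exact: measurable_above_mul.
apply: eq_integral => t; rewrite inE/= => -[_ /eqP ts].
by rewrite /below /above lt_neqAle eq_sym ts.
Qed.

Lemma tail_scale (p : R) s : (0 < p)%R ->
  tail (fun t => p%:E * f (t * p)%R) s = tail f (s * p)%R.
Proof.
move=> p0; rewrite [RHS](hintegral_scale p0); last 2 first.
  exact: measurable_above_mul.
  exact: above_mul_ge0.
rewrite -hintegralZ; last 3 first.
- apply: (measurableT_comp (measurable_above_mul _)).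
  exact: mulrl_measurable.
- by move=> t; exact: above_mul_ge0.
- by rewrite lee_fin ltW.
apply: eq_hintegral => t _; rewrite muleCA [(p * t)%R]mulrC; congr (_ * (_ * _)).
by rewrite /above ler_pM2r.
Qed.

End tail_facts.

Lemma tailD f g s : measurable_fun [set: R] f -> measurable_fun [set: R] g ->
  (forall t, 0 <= f t) -> (forall t, 0 <= g t) ->
  tail (fun t => f t + g t) s = tail f s + tail g s.
Proof.
move=> mf mg f0 g0; rewrite -hintegralD => [|||t|t].
- by apply: eq_hintegral => t _; rewrite ge0_muleDr.
- exact: measurable_above_mul.
- exact: measurable_above_mul.
- exact: above_mul_ge0.
- exact: above_mul_ge0.
Qed.

(** The square [[t, +oo)^2] is cut along the diagonal into [r <= w] and [w < r],
and each half is integrated with the smaller variable outside. *)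
Lemma tailM a b t : measurable_fun [set: R] a -> measurable_fun [set: R] b ->
  (forall r, 0 <= a r) -> (forall r, 0 <= b r) ->
  tail a t * tail b t = tail (fun r => a r * tail b r + b r * tail a r) t.
Proof.
move=> ma mb a0 b0; have mta := measurable_tail ma a0.
have mtb := measurable_tail mb b0.
have ta0 r := tail_ge0 a0 r; have tb0 r := tail_ge0 b0 r.
(* the contribution of the half w < r *)
pose F r w := above t w * b w * (below w r * a r).
have mF : measurable_fun [set: R * R] (fun z => F z.1 z.2).
  apply: emeasurable_funM; apply: emeasurable_funM.
  - by apply: measurable_above => //; exact: measurable_snd.
  - exact: measurableT_comp mb measurable_snd.
  - exact: measurable_below measurable_snd measurable_fst.
  - exact: measurableT_comp ma measurable_fst.
have F0 r w : 0 <= F r w by rewrite !mule_ge0 ?above_ge0 ?below_ge0.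
transitivity (hintegral (fun r => above t r * (a r * tail b r) + hintegral (F r))).
  rewrite muleC -hintegralZ//; last first.
  - by move=> r; exact: above_mul_ge0.
  - exact: measurable_above_mul.
  apply: eq_hintegral => r _; rewrite muleCA; have [tr|rt] := leP t r.
    rewrite {1 2}/above tr !mul1e.
    have mbelow : measurable_fun [set: R] (fun w => below w r).
      exact: measurable_below.
    have mab := @measurable_above_mul _ mb t.
    have -> : hintegral (F r) = a r * hintegral (fun w => above t w * b w * below w r).
      rewrite -hintegralZ//; last 2 first.
      - exact: emeasurable_funM.
      - by move=> w; rewrite !mule_ge0 ?above_ge0 ?below_ge0.
      by apply: eq_hintegral => w _; rewrite /F [RHS]muleC muleA.
    rewrite muleC -ge0_muleDr//; last first.
      by apply: hintegral_ge0 => w _; rewrite !mule_ge0 ?above_ge0 ?below_ge0.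
    congr (_ * _); rewrite -hintegralD; last 4 first.
    - exact: measurable_above_mul.
    - exact: emeasurable_funM.
    - by move=> w; exact: above_mul_ge0.
    - by move=> w; rewrite !mule_ge0 ?above_ge0 ?below_ge0.
    apply: eq_hintegral => w _; rewrite /above /below.
    have [rw|wr] := leP r w; first by rewrite (le_trans tr rw) mule0 adde0.
    by rewrite mule1 mul0e add0e.
  rewrite {1 2}/above leNgt rt !mul0e add0e.
  rewrite -[LHS](@integral0 _ _ _ (@lebesgue_measure R) `]0%R, +oo[%classic).
  apply: eq_hintegral => w _; rewrite /F /above /below.
  have [tw|wt] := leP t w; last by rewrite !mul0e.
  by rewrite ltNge (ltW (lt_le_trans rt tw)) mul0e mule0.
rewrite hintegralD; last 4 first.
- by apply: measurable_above_mul; exact: emeasurable_funM.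
- exact: measurable_hintegral.
- by move=> r; rewrite !mule_ge0 ?above_ge0.
- by move=> r; exact: hintegral_ge0.
rewrite tailD; last 4 first.
- exact: emeasurable_funM.
- exact: emeasurable_funM.
- by move=> r; rewrite mule_ge0.
- by move=> r; rewrite mule_ge0.
congr (_ + _); rewrite hintegral_tonelli//; apply: eq_hintegral => w _.
rewrite /F hintegralZ ?hintegral_below ?muleA//.
- by apply: emeasurable_funM => //; exact: measurable_below.
- by move=> r; rewrite mule_ge0 ?below_ge0.
- by rewrite mule_ge0 ?above_ge0.
Qed.

(** An infinite value at [t] would propagate to all of [(c, t]], where the weight
is positive, and make the integral infinite. *)
Lemma nonincreasing_lty (c : R) f (w : R -> R) : (0 <= c)%R ->
  measurable_fun [set: R] f -> measurable_fun [set: R] w ->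
  (forall t, 0 <= f t) -> (forall t, 0 <= w t)%R ->
  (forall s t, (0 < s)%R -> (s <= t)%R -> f t <= f s) ->
  (forall t, (c < t)%R -> (0 < w t)%R) ->
  hintegral (fun t => (w t)%:E * f t) < +oo -> forall t, (c < t)%R -> f t < +oo.
Proof.
move=> c0 mf mw f0 w0 ndf wp fty t ct; rewrite ltNge leye_eq; apply/eqP => fy.
move: fty; rewrite ltNge => /negP; apply.
have mwf : measurable_fun [set: R] (fun t => (w t)%:E * f t).
  by apply: emeasurable_funM => //; exact/measurable_EFinP.
apply: (@le_trans _ _ (\int[lebesgue_measure]_(s in `]c, t]) +oo)).
  rewrite integral_cst//= lebesgue_measure_itv/= lte_fin ct -EFinB.
  by rewrite gt0_mulye// lte_fin subr_gt0.
apply: (@le_trans _ _ (\int[lebesgue_measure]_(s in `]c, t]) ((w s)%:E * f s))).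
  apply: ge0_le_integral => //.
  - exact: measurable_funTS.
  - move=> s /=; rewrite in_itv/= => /andP[cs st].
    have : f t <= f s by apply: ndf => //; exact: le_lt_trans cs.
    by rewrite fy leye_eq => /eqP ->; rewrite gt0_muley// lte_fin wp.
apply: ge0_subset_integral => //.
- exact: measurable_funTS.
- by move=> s _; rewrite mule_ge0// lee_fin.
- by apply: subset_itv; rewrite bnd_simp.
Qed.

End tail_integral.

(** * The incomplete Gamma transform as a Laplace transform of tails *)

Section gamma_representation.
Context {R : realType}.
Local Open Scope ereal_scope.
Local Notation mu := (@lebesgue_measure R).
Implicit Types (l x y s t : R) (phi : R -> \bar R).

(** The integrand may be unbounded at [0], so the primitive is used on
[[y / (n + 2), y]] before letting [n] tend to infinity. *)
Lemma integral_powR_le l y : (0 < l)%R -> (0 < y)%R ->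
  \int[mu]_(t in `]0%R, y]) (t `^ (l - 1))%:E <= (y `^ l / l)%:E.
Proof.
move=> l0 y0; pose F n : set R := `[(y / n.+2%:R)%R, y]%classic.
have Fpos n t : F n t -> (0 < t)%R.
  by rewrite /F/= in_itv/= => /andP[+ _]; apply: lt_le_trans; rewrite divr_gt0.
have Fu : `]0%R, y]%classic = \bigcup_n F n.
  apply/seteqP; split=> [t|t [n _ Fnt]]; rewrite /= !in_itv/=.
    move=> /andP[t0 ty]; exists (Num.truncn (y / t)) => //.
    rewrite /F/= in_itv/= ty andbT ler_pdivrMr// mulrC -ler_pdivrMr//.
    by rewrite (le_trans (ltW (Num.Theory.truncnS_gt _)))// ler_nat.
  by rewrite (Fpos _ _ Fnt)/=; move: Fnt; rewrite /F/= in_itv/= => /andP[].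
have mf : measurable_fun [set: R] (fun t : R => (t `^ (l - 1))%:E).
  by apply/measurable_EFinP; exact: measurable_powR.
have ndF : nondecreasing_seq F.
  move=> n m nm; rewrite subsetEset; apply: subset_itvr; rewrite bnd_simp.
  by rewrite ler_pM2l// lef_pV2 ?posrE// ler_nat.
have cF : \int[mu]_(x in F i) (x `^ (l - 1))%:E @[i --> \oo] -->
    \int[mu]_(x in `]0%R, y]) (x `^ (l - 1))%:E.
  rewrite Fu; apply: ge0_nondecreasing_set_cvg_integral => //.
  - by move=> n; exact: measurable_itv.
  - by move=> n; exact: measurable_funTS.
  - by move=> n t _; rewrite lee_fin powR_ge0.
rewrite -(cvg_lim _ cF)//.
apply: lime_le; first by apply/cvg_ex; eexists; exact: cF.
apply: nearW => n; set a := (y / n.+2%:R)%R.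
have a0 : (0 < a)%R by rewrite divr_gt0.
have ay : (a < y)%R by rewrite ltr_pdivrMr// ltr_pMr// ltr1n.
have dp t : (0 < t)%R ->
    is_derive t (1%R : R) (fun u : R => l^-1 * u `^ l)%R (t `^ (l - 1))%R.
  move=> t0; apply: is_derive_eq.
    exact: (is_deriveZ _ (is_derive1_powR _ t0)).
  by rewrite /GRing.scale/= mulrA mulVf ?mul1r// gt_eqF.
have cp t (b : R) : (0 < t)%R -> {for t, continuous (fun u : R => u `^ b)%R}.
  move=> t0; apply/differentiable_continuous/derivable1_diffP.
  by have [] := is_derive1_powR b t0.
rewrite (@continuous_FTC2 _ _ (fun u => l^-1 * u `^ l)%R)//.
- rewrite -EFinB lee_fin [(y `^ l / l)%R]mulrC gerBl.
  by rewrite mulr_ge0 ?powR_ge0// invr_ge0 ltW.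
- apply: continuous_in_subspaceT => t; rewrite inE => /Fpos; exact: cp.
- have ct t : (0 < t)%R -> {for t, continuous (fun u : R => l^-1 * u `^ l)%R}.
    move=> t0; apply/differentiable_continuous/derivable1_diffP.
    by have [] := dp t t0.
  split.
  + move=> t; rewrite in_itv/= => /andP[at_ _].
    by have [] := dp t (lt_trans a0 at_).
  + by apply: cvg_at_right_filter; exact: ct.
  + by apply: cvg_at_left_filter; exact: ct.
- move=> t; rewrite in_itv/= => /andP[at_ _].
  by rewrite derive1E; have [_ ->] := dp t (lt_trans a0 at_).
Qed.

Definition gweight l x s : R := s `^ (l - 1) * expR (- (x * s)).

Lemma gweight_ge0 l x s : (0 <= gweight l x s)%R.
Proof. by rewrite mulr_ge0 ?powR_ge0 ?expR_ge0. Qed.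

Lemma gweight_gt0 l x s : (0 < s)%R -> (0 < gweight l x s)%R.
Proof. by move=> s0; rewrite mulr_gt0 ?powR_gt0 ?expR_gt0. Qed.

Lemma measurable_gweight l x : measurable_fun [set: R] (gweight l x).
Proof.
apply: measurable_funM; first exact: measurable_powR.
apply: measurableT_comp => //; apply: measurableT_comp => //.
Qed.

Lemma incomplete_gamma_ge0 l x : (0 <= incomplete_gamma l x)%R.
Proof. by apply: Rintegral_ge0 => t _; rewrite mulr_ge0 ?powR_ge0 ?expR_ge0. Qed.

Lemma integral_gweight_le l y : (0 < l)%R -> (0 < y)%R ->
  \int[mu]_(s in `]0%R, y]) (gweight l 1 s)%:E <= (y `^ l / l)%:E.
Proof.
move=> l0 y0; apply: le_trans (integral_powR_le l0 y0).
apply: ge0_le_integral => //.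
- by move=> s _; rewrite lee_fin gweight_ge0.
- apply: measurable_funTS; apply/measurable_EFinP; exact: measurable_gweight.
- by apply: measurable_funTS; apply/measurable_EFinP; exact: measurable_powR.
- move=> s /=; rewrite in_itv/= => /andP[s0 _].
  by rewrite lee_fin ler_piMr ?powR_ge0// mul1r -expR0 ler_expR oppr_le0 ltW.
Qed.

Lemma incomplete_gamma_EFin l y : (0 < l)%R -> (0 < y)%R ->
  (incomplete_gamma l y)%:E = \int[mu]_(s in `]0%R, y]) (gweight l 1 s)%:E.
Proof.
move=> l0 y0; rewrite -[RHS]fineK; last first.
  rewrite ge0_fin_numE; last first.
    by apply: integral_ge0 => s _; rewrite lee_fin gweight_ge0.
  exact: le_lt_trans (integral_gweight_le l0 y0) (ltry _).
rewrite /incomplete_gamma /Rintegral; congr (fine _)%:E.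
by apply: eq_integral => s _; rewrite /gweight mul1r.
Qed.

Lemma incomplete_gamma_le l y : (0 < l)%R -> (0 < y)%R ->
  (incomplete_gamma l y <= y `^ l / l)%R.
Proof.
by move=> l0 y0; rewrite -lee_fin incomplete_gamma_EFin// integral_gweight_le.
Qed.

Lemma incomplete_gamma_nondecreasing l y z : (0 < l)%R -> (0 < y)%R ->
  (y <= z)%R -> (incomplete_gamma l y <= incomplete_gamma l z)%R.
Proof.
move=> l0 y0 yz; rewrite -lee_fin !incomplete_gamma_EFin//; last first.
  exact: lt_le_trans yz.
apply: ge0_subset_integral => //.
- apply: measurable_funTS; apply/measurable_EFinP; exact: measurable_gweight.
- by move=> s _; rewrite lee_fin gweight_ge0.
- by apply: subset_itvl; rewrite bnd_simp.
Qed.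

(** Substitution [s := x s] in the defining integral, which separates the roles of
[x] and [t]. *)
Lemma incomplete_gammaE l x t : (0 < l)%R -> (0 < x)%R -> (0 < t)%R ->
  (incomplete_gamma l (x * t))%:E =
  (x `^ l)%:E * hintegral (fun s => above s t * (gweight l x s)%:E).
Proof.
move=> l0 x0 t0; have xt0 := mulr_gt0 x0 t0.
have mE y : measurable_fun [set: R] (fun s => (gweight l y s)%:E).
  by apply/measurable_EFinP; exact: measurable_gweight.
rewrite incomplete_gamma_EFin//.
have ma y : measurable_fun [set: R] (fun s => above s y * (gweight l 1 s)%:E).
  by apply: emeasurable_funM => //; exact: measurable_above.
have a0 y s : 0 <= above s y * (gweight l 1 s)%:E.
  by rewrite mule_ge0 ?above_ge0// lee_fin gweight_ge0.
transitivity (hintegral (fun s => above s (x * t) * (gweight l 1 s)%:E)).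
  have -> : `]0%R, (x * t)%R]%classic = `]0%R, +oo[ `&` [set s : R | (s <= x * t)%R].
    by apply/seteqP; split => s /=; rewrite !in_itv/= andbT => /andP.
  rewrite integral_mkcondr; apply: eq_integral => s _.
  rewrite patchE /above; have [sxt|xts] := leP s (x * t)%R.
    by rewrite mem_set// mul1e.
  by rewrite memNset ?mul0e//=; apply/negP; rewrite -ltNge.
rewrite (hintegral_scale x0 (ma _) (a0 _)) -hintegralZ; last 3 first.
- by apply: (measurableT_comp (ma (x * t)%R)); exact: mulrl_measurable.
- by move=> s; exact: a0.
- by rewrite lee_fin ltW.
rewrite -hintegralZ; last 3 first.
- by apply: emeasurable_funM => //; exact: measurable_above.
- by move=> s; rewrite mule_ge0 ?above_ge0// lee_fin gweight_ge0.
- by rewrite lee_fin powR_ge0.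
apply: eq_hintegral => s s0; rewrite /above ler_pM2l// muleCA [RHS]muleCA.
rewrite -!EFinM /gweight mul1r (powRM _ (ltW x0) (ltW s0)).
by congr EFin; rewrite -[in RHS](mulr_powRB1 (ltW x0) l0); ring.
Qed.

(** The Laplace transform, at [x], of [s^(l-1)] times the tail of [phi]. *)
Definition laplace l phi x := hintegral (fun s => (gweight l x s)%:E * tail phi s).

(** Tonelli on the region [s <= t]: integrating [phi] over [t >= s] first produces
its tail. *)
Lemma hintegral_gamma l x phi : (0 < l)%R -> (0 < x)%R ->
  measurable_fun [set: R] phi -> (forall t, 0 <= phi t) ->
  hintegral (fun t => (incomplete_gamma l (x * t))%:E * phi t) =
  (x `^ l)%:E * laplace l phi x.
Proof.
move=> l0 x0 mphi phi0.
have mw : measurable_fun [set: R] (fun s => (gweight l x s)%:E).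
  by apply/measurable_EFinP; exact: measurable_gweight.
have w0 s : 0 <= (gweight l x s)%:E by rewrite lee_fin gweight_ge0.
have xl0 : 0 <= (x `^ l)%:E by rewrite lee_fin powR_ge0.
pose F s t := (gweight l x s)%:E * (above s t * phi t).
have mF : measurable_fun [set: R * R] (fun z => F z.1 z.2).
  apply: emeasurable_funM; first exact: measurableT_comp mw measurable_fst.
  apply: emeasurable_funM; last exact: measurableT_comp mphi measurable_snd.
  exact: measurable_above measurable_fst measurable_snd.
have F0 s t : 0 <= F s t by rewrite !mule_ge0 ?above_ge0.
have mF' : measurable_fun [set: R * R] (fun z => F z.2 z.1).
  exact: (measurableT_comp mF (@measurable_swap _ _ R R)).
transitivity (hintegral (fun t => (x `^ l)%:E * hintegral (F^~ t))).
  apply: eq_hintegral => t t0; rewrite incomplete_gammaE// -muleA; congr (_ * _).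
  rewrite muleC -hintegralZ//; last 2 first.
  - by apply: emeasurable_funM => //; exact: measurable_above.
  - by move=> s; rewrite mule_ge0 ?above_ge0.
  by apply: eq_hintegral => s _; rewrite /F muleC -muleA muleCA.
rewrite hintegralZ//; last 2 first.
- exact: (@measurable_hintegral _ (fun t s => F s t)).
- by move=> t; exact: hintegral_ge0.
congr (_ * _); rewrite -hintegral_tonelli//; apply: eq_hintegral => s _.
rewrite hintegralZ//; first exact: measurable_above_mul.
by move=> t; exact: above_mul_ge0.
Qed.

End gamma_representation.

(** * Densities of completely monotonic order *)

Section cm_density.
Context {R : realType}.
Local Open Scope ereal_scope.
Local Notation mu := (@lebesgue_measure R).
Implicit Types (alpha beta l p r s t v x : R) (a b : R -> \bar R).

Lemma hintegral_integrable (f : R -> R) : measurable_fun (`]0%R, +oo[%classic : set R) f ->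
  (forall t, (0 < t)%R -> (0 <= f t)%R) -> hintegral (EFin \o f) < +oo ->
  mu.-integrable (`]0%R, +oo[%classic : set R) (EFin \o f).
Proof.
move=> mf f0 fy; apply/integrableP; split; first exact/measurable_EFinP.
rewrite -[X in X < _](_ : hintegral (EFin \o f) = _)//.
by apply: eq_hintegral => t t0; rewrite /= ger0_norm// f0.
Qed.

(** Extended-real densities that may occur as [phi] in the representation of a
Thorin-Bernstein function.  The finiteness of the tails is the integrability of
[phi] at infinity; integrability at [0] depends on the exponent and is kept
separate, as the finiteness of [laplace]. *)
Definition cm_density alpha a := [/\ measurable_fun [set: R] a,
  forall t, 0 <= a t, forall t, (0 < t)%R -> a t < +oo,
  forall t, (0 < t)%R -> tail a t < +oo &
  completely_monotonic_order alpha (fun t => fine (a t))].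

Lemma fineK_lty (y : \bar R) : 0 <= y -> y < +oo -> (fine y)%:E = y.
Proof. by move=> y0 yoo; rewrite fineK// ge0_fin_numE. Qed.

(** With [r = t v], [t^(alpha-1)] times the tail of [a] at [t] becomes the integral
over [v >= 1] of [v^(-alpha) g(v t)], where [g(r) = r^alpha a(r)]; each
[t |-> g(v t)] is completely monotonic. *)
Lemma cm_tail alpha a : cm_density alpha a ->
  completely_monotonic_order (alpha - 1) (fun t => fine (tail a t)).
Proof.
move=> [ma a0 ay tay cma].
pose g t : R := (t `^ alpha * fine (a t))%R.
have mg : measurable_fun [set: R] g.
  by apply: measurable_funM; [exact: measurable_powR|exact: measurableT_comp].
pose h v t : R := ((1 <= v)%R%:R * v `^ (- alpha) * g (v * t))%R.
have hE t : (0 < t)%R ->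
    hintegral (fun v => (h v t)%:E) = (t `^ (alpha - 1))%:E * tail a t.
  move=> t0.
  have mta : measurable_fun [set: R] (fun v => above t (t * v)%R * a (t * v)%R).
    have mt : measurable_fun [set: R] ( *%R t) by exact: mulrl_measurable.
    by apply: emeasurable_funM; [exact: measurable_above|exact: measurableT_comp].
  rewrite [tail _ _](hintegral_scale t0); last 2 first.
    exact: measurable_above_mul.
    by move=> v; exact: above_mul_ge0.
  have tE : (t `^ (alpha - 1) * t = t `^ alpha)%R.
    rewrite -[X in (_ * X)%R](powRr1 (ltW t0)) -powRD ?subrK//.
    by rewrite (gt_eqF t0) implybT.
  rewrite muleA -EFinM tE.
  rewrite -hintegralZ//; last by rewrite lee_fin powR_ge0.
  - apply: eq_hintegral => v v0; rewrite -[in RHS](@fineK_lty (a _))//; last first.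
      by rewrite ay// mulr_gt0.
    rewrite /above ler_pMr// -!EFinM; congr EFin.
    rewrite /h /g [(v * t)%R]mulrC (powRM _ (ltW t0) (ltW v0)) powRN.
    by field; rewrite gt_eqF// powR_gt0.
  - by move=> v; rewrite above_mul_ge0.
apply: (@cm_eq _ (fun t => (\int[mu]_(v in `]0%R, +oo[) h v t)%R)).
  move=> t t0; rewrite /Rintegral -/(hintegral _) hE// fineM//.
  by rewrite ge0_fin_numE ?tail_ge0// tay.
apply: cm_integral => //.
- move=> v /in_half v0; apply: cm_dilate => //.
  by rewrite mulr_ge0 ?powR_ge0.
- move=> t t0; apply: hintegral_integrable.
  + apply: measurable_funTS; apply: measurable_funM.
      apply: measurable_funM; last exact: measurable_powR.
      by apply/measurable_EFinP; exact: measurable_above.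
    by apply: (measurableT_comp mg); exact: mulrr_measurable.
  + move=> v v0; rewrite mulr_ge0 ?mulr_ge0 ?powR_ge0//.
    by rewrite fine_ge0.
  + by rewrite [X in X < _]hE// lte_mul_pinfty ?lee_fin ?powR_ge0// tay.
Qed.

(** The density whose tail is [t^(-l)]. *)
Definition powR_density l r : \bar R := (l * r `^ (- l - 1))%:E.

Lemma tail_powR_density l t : (0 < l)%R -> (0 < t)%R ->
  tail (powR_density l) t = (t `^ (- l))%:E.
Proof.
move=> l0 t0.
have dp s : (0 < s)%R ->
    is_derive s (1%R : R) (fun u : R => - u `^ (- l))%R (l * s `^ (- l - 1))%R.
  move=> s0; apply: is_derive_eq.
    exact: (is_deriveN (is_derive1_powR _ s0)).
  by rewrite mulNr opprK.
have cp s (c : R) : (0 < s)%R -> {for s, continuous (fun u : R => u `^ c)%R}.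
  move=> s0; apply/differentiable_continuous/derivable1_diffP.
  by have [] := is_derive1_powR c s0.
transitivity (\int[mu]_(s in `[t, +oo[) (l * s `^ (- l - 1))%:E).
  have -> : `[t, +oo[%classic = `]0%R, +oo[ `&` [set s : R | (t <= s)%R].
    apply/seteqP; split => s /=; rewrite !in_itv/= !andbT; last by case.
    by move=> ts; split => //; exact: lt_le_trans ts.
  rewrite integral_mkcondr; apply: eq_integral => s _.
  rewrite patchE /above; have [ts|st] := leP t s.
    by rewrite mem_set// mul1e.
  by rewrite memNset ?mul0e//=; apply/negP; rewrite -ltNge.
rewrite (@ge0_continuous_FTC2y _ _ (fun u => - u `^ (- l))%R _ 0%R).
- by rewrite EFinN sub0e oppeK.
- by move=> s _; rewrite mulr_ge0 ?powR_ge0// ltW.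
- apply: continuous_in_subspaceT => s; rewrite inE/= in_itv/= andbT => ts.
  apply: (@continuousM _ _ (cst l) (fun u : R => u `^ (- l - 1))%R).
    exact: cvg_cst.
  exact: cp (lt_le_trans t0 ts).
- rewrite -oppr0; apply: cvgN.
  have c0 : (fun u : R => u^-1 `^ l)%R @ +oo%R --> (0:R)%R.
    apply: (@cvg_comp _ _ _ (@GRing.inv R) (fun u => u `^ l)%R _ (0^'+)%R).
      move=> A [e /= e0 eA]; near=> u; have u0 : (0 < u)%R by [].
      apply: eA; rewrite /= ?invr_gt0// sub0r normrN gtr0_norm ?invr_gt0//.
      by rewrite invf_plt ?posrE//; near: u; apply: nbhs_pinfty_gt; rewrite num_real.
    exact: powR_cvg0.
  apply: cvg_trans c0; apply: near_eq_cvg; near=> u.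
  by rewrite -powR_inv1 -?powRrM ?mulN1r// ltW.
- by move=> s ts; have [] := dp s (lt_trans t0 ts).
- apply: cvgN; apply: cvg_at_right_filter; exact: cp.
- move=> s; rewrite in_itv/= andbT => ts.
  by rewrite derive1E; have [_ ->] := dp s (lt_trans t0 ts).
Unshelve. all: end_near. Qed.

Lemma cm_density_powR l alpha : (0 < l)%R -> (alpha <= l + 1)%R ->
  cm_density alpha (powR_density l).
Proof.
move=> l0 al; split.
- apply/measurable_EFinP; apply: measurable_funM => //; exact: measurable_powR.
- by move=> t; rewrite lee_fin mulr_ge0 ?powR_ge0// ltW.
- by move=> t _; exact: ltry.
- by move=> t t0; rewrite tail_powR_density// ltry.
- apply: (@cm_eq _ (fun t => l * (1 * t) `^ (- (l + 1 - alpha)))%R).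
    move=> t t0; rewrite mul1r /= mulrCA -powRD ?(gt_eqF t0) ?implybT//.
    by congr (_ * _ `^ _)%R; ring.
  have la0 : (0 <= l + 1 - alpha)%R by rewrite subr_ge0.
  exact: (cm_dilate (ltW l0) ltr01 (cm_powR la0)).
Qed.

(** Normalized so that the tail of [dilate p a] at [s] is the tail of [a] at
[s p]. *)
Definition dilate p a r : \bar R := p%:E * a (r * p)%R.

Lemma cm_density_dilate alpha p a : (0 < p)%R -> cm_density alpha a ->
  cm_density alpha (dilate p a).
Proof.
move=> p0 [ma a0 ay tay cma]; split.
- apply: emeasurable_funM => //; apply: (measurableT_comp ma).
  exact: mulrr_measurable.
- by move=> t; rewrite mule_ge0// lee_fin ltW.
- by move=> t t0; rewrite lte_mul_pinfty ?lee_fin ?ltW// ay// mulr_gt0.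
- by move=> t t0; rewrite tail_scale// tay// mulr_gt0.
- apply: cm_eq (cm_dilate (powR_ge0 p (1 - alpha)) p0 cma) => t t0.
  rewrite fineM//; last by rewrite ge0_fin_numE// ay// mulr_gt0.
  rewrite (powRM _ (ltW p0) (ltW t0)) [(p * t)%R]mulrC.
  rewrite powRB ?(gt_eqF p0) ?implybT// (powRr1 (ltW p0)) /=.
  by field; rewrite gt_eqF// powR_gt0.
Qed.

(** The density of the product of the two tails, by [tailM]. *)
Definition product_density a b r := a r * tail b r + b r * tail a r.

Lemma cm_orderM alpha beta (f g : R -> R) :
  completely_monotonic_order alpha f -> completely_monotonic_order beta g ->
  completely_monotonic_order (alpha + beta) (fun t => f t * g t)%R.
Proof.
move=> cf cg; apply: cm_eq (cmM cf cg) => t t0.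
by rewrite /= powRD ?(gt_eqF t0) ?implybT//; ring.
Qed.

Lemma cm_orderD alpha (f g : R -> R) :
  completely_monotonic_order alpha f -> completely_monotonic_order alpha g ->
  completely_monotonic_order alpha (fun t => f t + g t)%R.
Proof. by move=> cf cg; apply: cm_eq (cmD cf cg) => t t0; rewrite /= mulrDr. Qed.

Lemma cm_density_product alpha beta a b :
  cm_density alpha a -> cm_density beta b ->
  cm_density (alpha + beta - 1) (product_density a b).
Proof.
move=> da db; have cta := cm_tail da; have ctb := cm_tail db.
case: da => ma a0 ay tay cma; case: db => mb b0 bY tby cmb.
have taf t : (0 < t)%R -> tail a t \is a fin_num.
  by move=> t0; rewrite ge0_fin_numE ?tail_ge0// tay.
have tbf t : (0 < t)%R -> tail b t \is a fin_num.
  by move=> t0; rewrite ge0_fin_numE ?tail_ge0// tby.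
have af t : (0 < t)%R -> a t \is a fin_num by move=> t0; rewrite ge0_fin_numE// ay.
have bf t : (0 < t)%R -> b t \is a fin_num by move=> t0; rewrite ge0_fin_numE// bY.
split.
- by apply: emeasurable_funD; apply: emeasurable_funM => //; exact: measurable_tail.
- by move=> t; rewrite adde_ge0// mule_ge0// tail_ge0.
- move=> t t0; rewrite -ge0_fin_numE; last by rewrite adde_ge0// mule_ge0// tail_ge0.
  by rewrite fin_numD !fin_numM ?af ?bf ?taf ?tbf.
- move=> t t0; rewrite -tailM// -ge0_fin_numE; last by rewrite mule_ge0// tail_ge0.
  by rewrite fin_numM ?taf ?tbf.
- have ab := cm_orderM cma ctb; have ba := cm_orderM cmb cta.
  have ba' : completely_monotonic_order (alpha + (beta - 1))
      (fun t => fine (b t) * fine (tail a t))%R.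
    by have -> : (alpha + (beta - 1) = beta + (alpha - 1))%R by ring.
  rewrite -addrA; apply: cm_eq (cm_orderD ab ba') => t t0.
  rewrite /= -(fineM (af _ t0) (tbf _ t0)) -(fineM (bf _ t0) (taf _ t0)).
  by rewrite -fineD ?fin_numM ?af ?bf ?taf ?tbf.
Qed.

Lemma cm_densityD alpha a b : cm_density alpha a -> cm_density alpha b ->
  cm_density alpha (fun t => a t + b t).
Proof.
move=> [ma a0 ay tay cma] [mb b0 bY tby cmb]; split.
- exact: emeasurable_funD.
- by move=> t; rewrite adde_ge0.
- by move=> t t0; rewrite lte_add_pinfty ?ay ?bY.
- by move=> t t0; rewrite tailD// lte_add_pinfty ?tay ?tby.
- apply: cm_eq (cm_orderD cma cmb) => t t0.
  by rewrite /= fineD// ge0_fin_numE// ?ay ?bY.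
Qed.

Lemma tailZ (c : R) a s : (0 <= c)%R -> measurable_fun [set: R] a ->
  (forall t, 0 <= a t) -> tail (fun t => c%:E * a t) s = c%:E * tail a s.
Proof.
move=> c0 ma a0; rewrite /tail -hintegralZ.
- by apply: eq_hintegral => t _; rewrite muleCA.
- exact: measurable_above_mul.
- by move=> t; exact: above_mul_ge0.
- by rewrite lee_fin.
Qed.

Lemma cm_densityZ alpha (c : R) a : (0 <= c)%R -> cm_density alpha a ->
  cm_density alpha (fun t => c%:E * a t).
Proof.
move=> c0 [ma a0 ay tay cma]; split.
- exact: emeasurable_funM.
- by move=> t; rewrite mule_ge0.
- by move=> t t0; rewrite lte_mul_pinfty ?lee_fin// ay.
- by move=> t t0; rewrite tailZ// lte_mul_pinfty ?lee_fin// tay.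
- apply: cm_eq (cm_dilate c0 ltr01 cma) => t t0.
  rewrite !mul1r fineM//=; first ring.
  by rewrite ge0_fin_numE// ay.
Qed.

(** The superposition is finite at [t] because its tail at [t / 2] is finite and
because [t^alpha] times it is nonincreasing. *)
Lemma cm_density_hintegral alpha (F : R -> R -> \bar R) :
  measurable_fun [set: R * R] (fun z => F z.1 z.2) ->
  (forall v r, 0 <= F v r) ->
  (forall v, (0 < v)%R -> cm_density alpha (F v)) ->
  (forall t, (0 < t)%R -> tail (fun r => hintegral (F^~ r)) t < +oo) ->
  cm_density alpha (fun r => hintegral (F^~ r)).
Proof.
move=> mF F0 dF Fy.
have mF' : measurable_fun [set: R * R] (fun z => F z.2 z.1).
  exact: (measurableT_comp mF (@measurable_swap _ _ R R)).
have mFr r : measurable_fun [set: R] (F^~ r).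
  exact: (measurableT_comp mF (measurable_pair2 r)).
have mH : measurable_fun [set: R] (fun r => hintegral (F^~ r)).
  exact: (@measurable_hintegral _ (fun r v => F v r)).
have H0 r : 0 <= hintegral (F^~ r) by exact: hintegral_ge0.
pose h v t : R := (t `^ alpha * fine (F v t))%R.
have hE t : (0 < t)%R ->
    hintegral (fun v => (h v t)%:E) = (t `^ alpha)%:E * hintegral (F^~ t).
  move=> t0; rewrite -hintegralZ ?lee_fin ?powR_ge0//; apply: eq_hintegral => v v0.
  by rewrite EFinM fineK_lty//; have [] := dF v v0; auto.
have mh t : measurable_fun [set: R] (fun v => (h v t)%:E).
  apply/measurable_EFinP; apply: measurable_funM => //.
  exact: measurableT_comp (mFr t).
have h0 v t : (0 <= h v t)%R by rewrite mulr_ge0 ?powR_ge0 ?fine_ge0.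
have Hfin t : (0 < t)%R -> hintegral (F^~ t) < +oo.
  move=> t0; have t20 : (0 < t / 2)%R by rewrite divr_gt0.
  pose w s : R := ((t / 2 <= s)%R%:R * s `^ (- alpha))%R.
  have mw : measurable_fun [set: R] w.
    apply: measurable_funM; last exact: measurable_powR.
    by apply/measurable_EFinP; exact: measurable_above.
  suff: (t `^ alpha)%:E * hintegral (F^~ t) < +oo.
    case: (hintegral (F^~ t)) (H0 t) => [y| |//] _.
      by move=> _; rewrite ltry.
    by rewrite gt0_muley// lte_fin powR_gt0.
  apply: (@nonincreasing_lty _ (t / 2) (fun t => (t `^ alpha)%:E * hintegral (F^~ t)) w).
  - exact: ltW.
  - apply: emeasurable_funM => //; apply/measurable_EFinP; exact: measurable_powR.
  - exact: mw.
  - by move=> s; rewrite mule_ge0// lee_fin powR_ge0.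
  - by move=> s; rewrite mulr_ge0 ?powR_ge0.
  - move=> s r s0 sr; rewrite -!hE//; last exact: lt_le_trans sr.
    apply: le_hintegral => // [v|v v0]; first by rewrite lee_fin.
    rewrite lee_fin; have [_ _ _ _ cF] := dF v v0.
    exact: cm_nonincreasing cF s0 sr.
  - by move=> s ts; rewrite /w (ltW ts) mul1r powR_gt0// (lt_trans t20).
  - rewrite [X in X < _](_ : _ = tail (fun r => hintegral (F^~ r)) (t / 2)%R) ?Fy//.
    apply: eq_hintegral => s s0; rewrite muleA -EFinM /w -mulrA powRN mulVf ?mulr1//.
    by rewrite gt_eqF// powR_gt0.
  - lra.
split=> //.
apply: (@cm_eq _ (fun t => (\int[mu]_(v in `]0%R, +oo[) h v t)%R)).
  move=> t t0; rewrite /Rintegral -/(hintegral _) hE// fineM//.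
  by rewrite ge0_fin_numE// Hfin.
apply: cm_integral => //.
- by move=> v /in_half v0; have [] := dF v v0.
- move=> t t0; apply: hintegral_integrable => //.
  + by apply: measurable_funTS; apply/measurable_EFinP; exact: mh.
  + by rewrite [X in X < _]hE// lte_mul_pinfty ?lee_fin ?powR_ge0// Hfin.
Qed.

End cm_density.

(** * Convolution *)

Section convolution.
Context {R : realType}.
Local Open Scope ereal_scope.
Implicit Types (alpha beta l p r s t v x : R) (a b : R -> \bar R).

Lemma tail_hintegral (F : R -> R -> \bar R) s :
  measurable_fun [set: R * R] (fun z => F z.1 z.2) ->
  (forall v r, 0 <= F v r) ->
  tail (fun r => hintegral (F^~ r)) s = hintegral (fun v => tail (F v) s).
Proof.
move=> mF F0.
have mFr r : measurable_fun [set: R] (F^~ r).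
  exact: (measurableT_comp mF (measurable_pair2 r)).
rewrite /tail hintegral_tonelli => [||v r]; last 2 first.
- apply: emeasurable_funM => //.
  by apply: measurable_above => //; exact: measurable_snd.
- by rewrite mule_ge0 ?above_ge0.
apply: eq_hintegral => r _; rewrite hintegralZ ?above_ge0//.
Qed.

(** Two positive arguments [s] and [s v] are the fractions [1 / (1 + v)] and
[v / (1 + v)] of their sum.  The absolute value makes both shares nonnegative and
measurable on the whole line, which spares conditions on [v]. *)
Definition left_share v : R := (1 + `|v|) `^ (-1).
Definition right_share v : R := `|v| * left_share v.

Lemma left_shareE v : (0 < v)%R -> left_share v = (1 + v)^-1%R.
Proof. by move=> v0; rewrite /left_share gtr0_norm// powR_inv1// addr_ge0// ltW. Qed.

Lemma left_share_gt0 v : (0 < left_share v)%R.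
Proof. by rewrite powR_gt0// ltr_pwDl. Qed.

Lemma right_share_ge0 v : (0 <= right_share v)%R.
Proof. by rewrite mulr_ge0// ltW// left_share_gt0. Qed.

Lemma right_share_gt0 v : (0 < v)%R -> (0 < right_share v)%R.
Proof. by move=> v0; rewrite mulr_gt0 ?normr_gt0 ?gt_eqF// left_share_gt0. Qed.

Lemma measurable_left_share : measurable_fun [set: R] left_share.
Proof.
apply: (measurableT_comp (@measurable_powR R (-1))).
by apply: measurable_funD => //; exact: measurableT_comp.
Qed.

Lemma measurable_right_share : measurable_fun [set: R] right_share.
Proof.
by apply: measurable_funM => //; exact: measurable_left_share.
Qed.

(** The convolution of [s^(l1-1) Phi1] and [s^(l2-1) Phi2] at [t] is
[t^(l1+l2-1)] times the integral of [share_weight v * Phi1 (p t) * Phi2 (q t)],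
where [p] and [q] are the shares of [v]. *)
Definition share_weight l1 l2 v : R :=
  left_share v `^ (l1 + l2) * v `^ (l2 - 1).

Definition split_density l1 l2 a b v r : \bar R :=
  (share_weight l1 l2 v)%:E *
  (dilate (left_share v) a r * tail b (r * right_share v)%R +
   dilate (right_share v) b r * tail a (r * left_share v)%R).

Definition convolution_density l1 l2 a b r :=
  hintegral (fun v => split_density l1 l2 a b v r).

Section facts.
Variables (l1 l2 : R) (a b : R -> \bar R).
Hypotheses (ma : measurable_fun [set: R] a) (a0 : forall t, 0 <= a t).
Hypotheses (mb : measurable_fun [set: R] b) (b0 : forall t, 0 <= b t).

Let mta := measurable_tail ma a0.
Let mtb := measurable_tail mb b0.
Let ta0 s : 0 <= tail a s. Proof. exact: tail_ge0. Qed.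
Let tb0 s : 0 <= tail b s. Proof. exact: tail_ge0. Qed.

Let weight0 v : 0 <= (share_weight l1 l2 v)%:E.
Proof. by rewrite lee_fin mulr_ge0 ?powR_ge0. Qed.

Let mweight : measurable_fun [set: R] (fun v => (share_weight l1 l2 v)%:E).
Proof.
apply/measurable_EFinP; apply: measurable_funM; last exact: measurable_powR.
exact: (measurableT_comp (@measurable_powR R (l1 + l2)) measurable_left_share).
Qed.

Let mleft : measurable_fun [set: R * R] (fun z => left_share z.1).
Proof. exact: measurableT_comp measurable_left_share measurable_fst. Qed.

Let mright : measurable_fun [set: R * R] (fun z => right_share z.1).
Proof. exact: measurableT_comp measurable_right_share measurable_fst. Qed.

Let mscaled (f : R -> \bar R) (c : R * R -> R) : measurable_fun [set: R] f ->
  measurable_fun setT c -> measurable_fun [set: R * R] (fun z => f (z.2 * c z)%R).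
Proof.
by move=> mf mc; apply: (measurableT_comp mf); exact: measurable_funM.
Qed.

Lemma measurable_split_density :
  measurable_fun [set: R * R] (fun z => split_density l1 l2 a b z.1 z.2).
Proof.
apply: emeasurable_funM; first exact: measurableT_comp mweight measurable_fst.
apply: emeasurable_funD; apply: emeasurable_funM.
- apply: emeasurable_funM; first exact/measurable_EFinP.
  exact: (mscaled ma mleft).
- exact: (mscaled mtb mright).
- apply: emeasurable_funM; first exact/measurable_EFinP.
  exact: (mscaled mb mright).
- exact: (mscaled mta mleft).
Qed.

Lemma split_density_ge0 v r : 0 <= split_density l1 l2 a b v r.
Proof.
rewrite mule_ge0// adde_ge0// !mule_ge0 ?lee_fin ?right_share_ge0//.
by rewrite ltW// left_share_gt0.
Qed.

Lemma split_densityE v r : (0 < v)%R -> split_density l1 l2 a b v r =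
  (share_weight l1 l2 v)%:E *
  product_density (dilate (left_share v) a) (dilate (right_share v) b) r.
Proof.
move=> v0; rewrite /product_density !tail_scale//.
- exact: left_share_gt0.
- exact: right_share_gt0.
Qed.

Lemma tail_split_density v s : (0 < v)%R -> tail (split_density l1 l2 a b v) s =
  (share_weight l1 l2 v)%:E *
  (tail a (s * left_share v)%R * tail b (s * right_share v)%R).
Proof.
move=> v0.
have mdil (c : R) (f : R -> \bar R) : measurable_fun [set: R] f ->
    measurable_fun [set: R] (dilate c f).
  move=> mf; apply: emeasurable_funM => //; apply: (measurableT_comp mf).
  exact: mulrr_measurable.
have dil0 (c : R) (f : R -> \bar R) : (0 < c)%R -> (forall t, 0 <= f t) ->
    forall t, 0 <= dilate c f t.
  by move=> c0 f0 t; rewrite mule_ge0// lee_fin ltW.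
have p0 := left_share_gt0 v; have q0 := right_share_gt0 v0.
have tdil (c : R) (f : R -> \bar R) t : (0 < c)%R -> (forall t, 0 <= f t) ->
    0 <= tail (dilate c f) t.
  by move=> c0 f0; apply: tail_ge0; exact: dil0.
transitivity (tail (fun r => (share_weight l1 l2 v)%:E *
    product_density (dilate (left_share v) a) (dilate (right_share v) b) r) s).
  by apply: eq_hintegral => r _; rewrite split_densityE.
have w0 : (0 <= share_weight l1 l2 v)%R by rewrite -lee_fin.
rewrite tailZ//.
- rewrite -tailM ?tail_scale//; [exact: mdil|exact: mdil|exact: dil0|exact: dil0].
- apply: emeasurable_funD; apply: emeasurable_funM; try exact: mdil;
    by apply: measurable_tail; [exact: mdil|exact: dil0].
- by move=> t; rewrite adde_ge0// mule_ge0 ?tdil ?dil0.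
Qed.

(** The product of the two transforms is a double integral in [s] and [s' = s v];
for fixed [v], the total [t = (1 + v) s] is the new variable.  Only dilations are
needed, no translation. *)
Lemma laplace_convolution x :
  laplace (l1 + l2) (convolution_density l1 l2 a b) x =
  laplace l1 a x * laplace l2 b x.
Proof.
have mg l : measurable_fun [set: R] (fun s => (gweight l x s)%:E).
  by apply/measurable_EFinP; exact: measurable_gweight.
have g0 l s : 0 <= (gweight l x s)%:E by rewrite lee_fin gweight_ge0.
pose S s v := (gweight (l1 + l2) x s)%:E * ((share_weight l1 l2 v)%:E *
  (tail a (s * left_share v)%R * tail b (s * right_share v)%R)).
have mw := measurableT_comp mweight (@measurable_snd _ _ R R).
have mscale (f : R -> \bar R) (c : R -> R) : measurable_fun [set: R] f ->
    measurable_fun [set: R] c ->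
    measurable_fun [set: R * R] (fun z => f (z.1 * c z.2)%R).
  move=> mf mc; apply: (measurableT_comp mf); apply: measurable_funM => //.
  exact: measurableT_comp mc measurable_snd.
have mS : measurable_fun [set: R * R] (fun z => S z.1 z.2).
  apply: emeasurable_funM; first exact: measurableT_comp (mg _) measurable_fst.
  apply: emeasurable_funM => //; apply: emeasurable_funM.
    exact: mscale mta measurable_left_share.
  exact: mscale mtb measurable_right_share.
have S0 s v : 0 <= S s v by rewrite !mule_ge0.
pose G t := (gweight l2 x t)%:E * tail b t.
have mG : measurable_fun [set: R] G by exact: emeasurable_funM.
have G0 t : 0 <= G t by rewrite mule_ge0.
pose T s v := (gweight l1 x s)%:E * tail a s * (`|s|%:E * G (s * v)%R).
have mT : measurable_fun [set: R * R] (fun z => T z.1 z.2).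
  apply: emeasurable_funM.
    apply: emeasurable_funM; first exact: measurableT_comp (mg _) measurable_fst.
    exact: measurableT_comp mta measurable_fst.
  apply: emeasurable_funM; last exact: mscale mG (@measurable_id _ _ _).
  by apply/measurable_EFinP; apply: measurableT_comp => //.
have T0 s v : 0 <= T s v by rewrite !mule_ge0.
transitivity (hintegral (fun s => hintegral (S s))).
  apply: eq_hintegral => s _; rewrite tail_hintegral; last 2 first.
  - exact: measurable_split_density.
  - exact: split_density_ge0.
  rewrite -hintegralZ//.
  - by apply: eq_hintegral => v v0; rewrite tail_split_density.
  - apply: (@measurable_hintegral _ (fun v r => above s r * split_density l1 l2 a b v r)).
      apply: emeasurable_funM; last exact: measurable_split_density.
      by apply: measurable_above => //; exact: measurable_snd.
    by move=> v r; rewrite mule_ge0 ?above_ge0 ?split_density_ge0.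
  - by move=> v; apply: tail_ge0 => r; exact: split_density_ge0.
rewrite hintegral_tonelli//.
(* for fixed v, the substitution s := (1 + v) s *)
transitivity (hintegral (fun v => hintegral (T^~ v))).
  apply: eq_hintegral => v v0; have c0 : (0 < 1 + v)%R by rewrite addr_gt0.
  have mSv := measurableT_comp mS (measurable_pair2 v).
  rewrite (hintegral_scale c0)// -hintegralZ; last 3 first.
  - by apply: (measurableT_comp mSv); exact: mulrl_measurable.
  - by move=> s; exact: S0.
  - by rewrite lee_fin ltW.
  apply: eq_hintegral => s s0; rewrite /S /T /G gtr0_norm//.
  have -> : ((1 + v) * s * left_share v = s)%R.
    by rewrite left_shareE//; field; rewrite gt_eqF.
  have -> : ((1 + v) * s * right_share v = s * v)%R.
    by rewrite /right_share left_shareE// gtr0_norm//; field; rewrite gt_eqF.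
  rewrite !muleA [X in _ = X * _ * _]muleAC [X in _ = X * _]muleAC -!EFinM.
  congr (_%:E * _ * _).
  rewrite /gweight /share_weight left_shareE// -powR_inv1 ?ltW// -powRrM mulN1r.
  rewrite powRN !(powRM _ (ltW c0) (ltW s0)) !(powRM _ (ltW s0) (ltW v0)).
  have powB1 (u l : R) : (0 < u -> u `^ (l - 1) = u `^ l / u)%R.
    by move=> u0; rewrite powRB ?(gt_eqF u0) ?implybT// powRr1// ltW.
  have powD (u l l' : R) : (0 < u -> u `^ (l + l') = u `^ l * u `^ l')%R.
    by move=> u0; rewrite powRD// (gt_eqF u0) implybT.
  have -> : (- (x * ((1 + v) * s)) = - (x * s) + - (x * (s * v)))%R by ring.
  rewrite expRD !powB1// !powD//; field.
  by rewrite !gt_eqF// powR_gt0.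
rewrite -hintegral_tonelli// [RHS]muleC -hintegralZ; last 3 first.
- exact: emeasurable_funM.
- by move=> s; rewrite mule_ge0.
- by apply: hintegral_ge0 => s _; rewrite mule_ge0.
apply: eq_hintegral => s s0.
have mGs : measurable_fun [set: R] (fun v => G (s * v)%R).
  by apply: (measurableT_comp mG); exact: mulrl_measurable.
rewrite hintegralZ ?mule_ge0//; last 2 first.
- by apply: emeasurable_funM.
- by move=> v; rewrite mule_ge0.
rewrite [RHS]muleC; congr (_ * _).
by rewrite /laplace (hintegral_scale s0 mG G0) -hintegralZ ?gtr0_norm// lee_fin ltW.
Qed.

End facts.

(** That the convolution density is finite comes from the finiteness of its Laplace
transform, a product of two finite ones. *)
Lemma cm_density_convolution alpha beta l1 l2 a b :
  cm_density alpha a -> cm_density beta b ->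
  laplace l1 a 1 < +oo -> laplace l2 b 1 < +oo ->
  cm_density (alpha + beta - 1) (convolution_density l1 l2 a b).
Proof.
move=> da db La Lb.
have [ma a0 _ _ _] := da; have [mb b0 _ _ _] := db.
have mF := measurable_split_density l1 l2 ma a0 mb b0.
have F0 v r := split_density_ge0 l1 l2 a0 b0 v r.
pose C := convolution_density l1 l2 a b.
have mC : measurable_fun [set: R] C.
  apply: (@measurable_hintegral _ (fun r v => split_density l1 l2 a b v r)).
    exact: (measurableT_comp mF (@measurable_swap _ _ R R)).
  by move=> r v; exact: F0.
have C0 r : 0 <= C r by apply: hintegral_ge0 => v _; exact: F0.
have La0 : 0 <= laplace l1 a 1.
  by apply: hintegral_ge0 => s _; rewrite mule_ge0 ?tail_ge0// lee_fin gweight_ge0.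
have Cy : laplace (l1 + l2) C 1 < +oo.
  have Laf : laplace l1 a 1 \is a fin_num by rewrite (ge0_fin_numE La0); exact: La.
  rewrite (laplace_convolution l1 l2 ma a0 mb b0).
  exact: lte_mul_pinfty La0 Laf Lb.
apply: (cm_density_hintegral mF F0).
- move=> v v0.
  have -> : split_density l1 l2 a b v = fun r => (share_weight l1 l2 v)%:E *
      product_density (dilate (left_share v) a) (dilate (right_share v) b) r.
    by apply/funext => r; exact: split_densityE.
  apply: cm_densityZ; first by rewrite mulr_ge0 ?powR_ge0.
  apply: cm_density_product; apply: cm_density_dilate => //.
    exact: left_share_gt0.
  exact: right_share_gt0.
- apply: (nonincreasing_lty (lexx 0%R) (measurable_tail mC C0)
    (@measurable_gweight _ (l1 + l2) 1) _ _ _ _ Cy).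
  + by move=> t; exact: tail_ge0.
  + by move=> t; exact: gweight_ge0.
  + by move=> s t _ st; exact: tail_nonincreasing.
  + by move=> t; exact: gweight_gt0.
Qed.

End convolution.

(** * Products of Thorin-Bernstein functions *)

Section thorin_bernstein.
Context {R : realType}.
Local Open Scope ereal_scope.
Local Notation mu := (@lebesgue_measure R).
Local Notation D := (`]0%R, +oo[%classic : set R).
Implicit Types (alpha beta l m x A : R) (a b : R -> \bar R) (f : R -> R).

Lemma laplace_ge0 l a x : (forall t, 0 <= a t) -> 0 <= laplace l a x.
Proof.
move=> a0; apply: hintegral_ge0 => s _.
by apply: mule_ge0; [rewrite lee_fin gweight_ge0|exact: tail_ge0].
Qed.

Let mg l x : measurable_fun [set: R] (fun s => (gweight l x s)%:E).
Proof. by apply/measurable_EFinP; exact: measurable_gweight. Qed.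

Let g0 l x s : 0 <= (gweight l x s)%:E.
Proof. by rewrite lee_fin gweight_ge0. Qed.

Lemma laplaceD l a b x : measurable_fun [set: R] a ->
  measurable_fun [set: R] b -> (forall t, 0 <= a t) -> (forall t, 0 <= b t) ->
  laplace l (fun t => a t + b t) x = laplace l a x + laplace l b x.
Proof.
move=> ma mb a0 b0.
have mta := measurable_tail ma a0; have mtb := measurable_tail mb b0.
have ta0 s := tail_ge0 a0 s; have tb0 s := tail_ge0 b0 s.
rewrite /laplace -hintegralD; last 4 first.
- exact: emeasurable_funM (mg l x) mta.
- exact: emeasurable_funM (mg l x) mtb.
- by move=> s; exact: mule_ge0.
- by move=> s; exact: mule_ge0.
by apply: eq_hintegral => s _; rewrite (tailD _ ma mb a0 b0) ge0_muleDr.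
Qed.

Lemma laplaceZ l (c : R) a x : (0 <= c)%R -> measurable_fun [set: R] a ->
  (forall t, 0 <= a t) -> laplace l (fun t => c%:E * a t) x = c%:E * laplace l a x.
Proof.
move=> c0 ma a0; have mta := measurable_tail ma a0.
rewrite /laplace -hintegralZ; last 3 first.
- exact: emeasurable_funM (mg l x) mta.
- by move=> s; apply: mule_ge0 => //; exact: tail_ge0.
- by rewrite lee_fin.
by apply: eq_hintegral => s _; rewrite (tailZ _ c0 ma a0) muleCA.
Qed.

(** By [tailM] the tail of this product density is [s^(-l)] times that of [b], and
the power lowers the exponent of the transform from [l + m] to [m]. *)
Lemma laplace_powR l m b x : (0 < l)%R -> measurable_fun [set: R] b ->
  (forall t, 0 <= b t) ->
  laplace (l + m) (product_density (powR_density l) b) x = laplace m b x.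
Proof.
move=> l0 mb b0; apply: eq_hintegral => s s0.
have [mp p0 _ _ _] := cm_density_powR l0 (lexx (l + 1)%R).
rewrite -(tailM _ mp mb p0 b0) tail_powR_density// muleA -EFinM.
congr (_%:E * _); rewrite /gweight mulrAC -powRD ?(gt_eqF s0) ?implybT//.
by congr (_ `^ _ * _)%R; ring.
Qed.

Lemma measurable_gamma l x : (0 < l)%R -> (0 < x)%R ->
  measurable_fun D (fun t => incomplete_gamma l (x * t)).
Proof.
move=> l0 x0; apply/measurable_EFinP.
apply: (@eq_measurable_fun _ _ _ _ _ (fun t => (x `^ l)%:E *
    hintegral (fun s => above s t * (gweight l x s)%:E))).
  by move=> t; rewrite inE => /in_half t0; rewrite /= incomplete_gammaE.
apply: measurable_funTS; apply: emeasurable_funM => //.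
apply: (@measurable_hintegral _ (fun t s => above s t * (gweight l x s)%:E)).
  apply: emeasurable_funM; last exact: measurableT_comp (mg l x) measurable_snd.
  exact: measurable_above measurable_snd measurable_fst.
by move=> t s; apply: mule_ge0 => //; exact: above_ge0.
Qed.

Lemma thorin_bernstein_of_density l alpha A a f : (0 < l)%R -> (0 <= A)%R ->
  cm_density alpha a -> (forall x, (0 < x)%R -> laplace l a x < +oo) ->
  (forall x, (0 < x)%R -> f x = (x `^ l * (A + fine (laplace l a x)))%R) ->
  thorin_bernstein l alpha f.
Proof.
move=> l0 A0 [ma a0 ay _ cma] Ly fE.
have hE x : (0 < x)%R ->
    hintegral (fun t => (incomplete_gamma l (x * t) * fine (a t))%:E) =
    (x `^ l)%:E * laplace l a x.
  move=> x0; rewrite -hintegral_gamma//; apply: eq_hintegral => t t0.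
  by rewrite EFinM (fineK_lty (a0 t) (ay _ t0)).
exists A, 0%R, (fun t => fine (a t)); split=> // x x0.
- apply: hintegral_integrable.
  + apply: measurable_funM; first exact: measurable_gamma.
    by apply: measurable_funTS; exact: measurableT_comp.
  + by move=> t t0; apply: mulr_ge0; [exact: incomplete_gamma_ge0|exact: fine_ge0].
  + rewrite [X in X < _]hE//; apply: lte_mul_pinfty => //; last exact: Ly.
    by rewrite lee_fin powR_ge0.
- rewrite fE// addr0 mulrDr [(A * _)%R]mulrC /Rintegral -/(hintegral _) hE//.
  by rewrite fineM// ge0_fin_numE ?laplace_ge0// Ly.
Qed.

(** Monotonicity reduces the limit to a sequence, to which dominated convergence
applies. *)
Lemma ge0_nondecreasing_cvg_at_right0 (J : R -> R) :
  (forall x, 0 <= J x)%R ->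
  (forall x y, (0 < x)%R -> (x <= y)%R -> (J x <= J y)%R) ->
  J (n.+1%:R^-1)%R @[n --> \oo] --> (0 : R)%R ->
  J x @[x --> 0^'+] --> (0 : R)%R.
Proof.
move=> J0 Jle Jn; apply/cvgrPdist_lt => e e0.
move/cvgrPdist_lt : Jn => /(_ e e0)[N _ /(_ N (leqnn _))].
rewrite sub0r normrN ger0_norm// => JN.
near=> x; rewrite sub0r normrN ger0_norm//; apply: le_lt_trans JN.
apply: Jle; near: x; first exact: nbhs_right_gt.
by apply: nbhs_right_le; rewrite invr_gt0.
Unshelve. all: end_near. Qed.

Lemma gamma_transform_cvg0 l (phi : R -> R) : (0 < l)%R ->
  (forall t, (0 < t)%R -> (0 <= phi t)%R) ->
  (forall x, (0 < x)%R -> mu.-integrable D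
    (fun t => (incomplete_gamma l (x * t) * phi t)%:E)) ->
  (\int[mu]_(t in D) (incomplete_gamma l (x * t) * phi t))%R @[x --> 0^'+]
    --> (0 : R)%R.
Proof.
move=> l0 phi0 iphi.
pose J x := (\int[mu]_(t in D) (incomplete_gamma l (x * t) * phi t))%R.
have J0 x : (0 <= J x)%R.
  apply: Rintegral_ge0 => t /in_half t0.
  by rewrite mulr_ge0 ?phi0// incomplete_gamma_ge0.
have Jle x y : (0 < x)%R -> (x <= y)%R -> (J x <= J y)%R.
  move=> x0 xy; apply: le_Rintegral => //; first exact: iphi.
  - by apply: iphi; exact: lt_le_trans xy.
  - move=> t /in_half t0; rewrite ler_wpM2r ?phi0//.
    by rewrite incomplete_gamma_nondecreasing ?mulr_gt0// ler_pM2r.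
have Jn : J (n.+1%:R^-1)%R @[n --> \oo] --> (0 : R)%R.
  rewrite -[X in _ --> X](_ : (\int[mu]_(t in D) 0)%R = 0%R); last first.
    by rewrite /Rintegral integral0.
  apply: fine_cvg; rewrite fineK; last by rewrite integral0.
  apply: (@dominated_cvg _ _ _ mu D _
    (fun n t => (incomplete_gamma l (n.+1%:R^-1 * t) * phi t)%:E) (cst 0%:E)
    (fun t => (incomplete_gamma l (1 * t) * phi t)%:E)) => //.
  - by move=> n; apply: (measurable_int mu); apply: iphi; rewrite invr_gt0.
  - move=> t /in_half t0; apply: cvg_EFin; first exact: nearW.
    pose u n : R := (n.+1%:R^-1 * t)%R.
    have u0 n : (0 < u n)%R by rewrite mulr_gt0// invr_gt0.
    have cu : u n @[n --> \oo] --> (0 : R)%R.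
      by rewrite -[X in _ --> X](mul0r t); apply: cvgMl; exact: cvg_harmonic.
    have cul := (cvg_at_rightP _ _ _).1 (powR_cvg0 l0) u (conj u0 cu).
    apply: (@squeeze_cvgr _ _ _ _ (cst 0%R) (fun n => u n `^ l / l * phi t)%R).
    + apply: nearW => n; rewrite /= mulr_ge0 ?phi0 ?incomplete_gamma_ge0//=.
      by rewrite ler_wpM2r ?phi0//; exact: incomplete_gamma_le l0 (u0 n).
    + exact: cvg_cst.
    + rewrite -[X in _ --> X](mul0r (phi t)) -[X in (X * _)%R](mul0r (l^-1)%R).
      by do 2 (apply: cvgM; last exact: cvg_cst).
  - exact: iphi.
  - move=> n t /in_half t0.
    rewrite gee0_abs lee_fin; last by rewrite mulr_ge0 ?phi0// incomplete_gamma_ge0.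
    rewrite ler_wpM2r ?phi0// incomplete_gamma_nondecreasing ?mulr_gt0//.
    by rewrite ler_pM2r// invf_le1// ler1n.
exact: (ge0_nondecreasing_cvg_at_right0 J0 Jle Jn).
Qed.

(** The constant [B] is [f(0)], so subtracting [value_at0 f] removes it; [phi] is
replaced by [0] outside the positive half-line, where it is arbitrary. *)
Lemma density_of_thorin_bernstein l alpha f : (0 < l)%R ->
  thorin_bernstein l alpha f ->
  exists A a, [/\ (0 <= A)%R, cm_density alpha a,
    forall x, (0 < x)%R -> laplace l a x < +oo &
    forall x, (0 < x)%R ->
      (f x - value_at0 f = x `^ l * (A + fine (laplace l a x)))%R].
Proof.
move=> l0 [A [B [phi [A0 B0 cphi iphi fE]]]].
have phiE t : (0 < t)%R -> phi t = (t `^ (- alpha) * (t `^ alpha * phi t))%R.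
  by move=> t0; rewrite powRN mulKf// gt_eqF// powR_gt0.
have phi0 t : (0 < t)%R -> (0 <= phi t)%R.
  by move=> t0; rewrite phiE// mulr_ge0 ?powR_ge0// (cm_ge0 cphi).
pose a t : \bar R := ((phi \_ D) t)%:E.
have aE t : (0 < t)%R -> a t = (phi t)%:E.
  by move=> t0; rewrite /a patchE mem_set//; apply/in_half.
have a0 t : 0 <= a t.
  rewrite lee_fin patchE; case: ifPn => //; rewrite inE => /in_half; exact: phi0.
have mphi : measurable_fun D phi.
  apply: (@eq_measurable_fun _ _ _ _ _
    (fun t => t `^ (- alpha) * (t `^ alpha * phi t))%R).
    by move=> t; rewrite inE => /in_half t0; rewrite -phiE.
  apply: measurable_funM; first by apply: measurable_funTS; exact: measurable_powR.
  apply: open_continuous_measurable_fun => //.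
  by move=> t; rewrite inE => /in_half t0; exact: cm_continuous cphi t0.
have ma : measurable_fun [set: R] a.
  by apply/measurable_EFinP; apply/(measurable_restrictT _ _).1.
have hE x : (0 < x)%R -> hintegral (fun t => (incomplete_gamma l (x * t) * phi t)%:E) =
    (x `^ l)%:E * laplace l a x.
  by move=> x0; rewrite -hintegral_gamma//; apply: eq_hintegral => t t0; rewrite aE.
have Ly x : (0 < x)%R -> laplace l a x < +oo.
  move=> x0; have hf : (x `^ l)%:E * laplace l a x \is a fin_num.
    by rewrite -hE//; apply: integrable_fin_num => //; exact: iphi.
  case: (laplace l a x) (laplace_ge0 l x a0) hf => [y _ _|_|//].
    exact: ltry.
  by rewrite gt0_muley// lte_fin powR_gt0.
have fE' x : (0 < x)%R -> (f x = x `^ l * (A + fine (laplace l a x)) + B)%R.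
  move=> x0; rewrite fE// /Rintegral -/(hintegral _) hE// fineM//=.
    by ring.
  by rewrite ge0_fin_numE ?laplace_ge0// Ly.
have f0 : value_at0 f = B.
  apply/cvg_lim => //.
  have cf : (A * x `^ l + B + \int[mu]_(t in D)
      (incomplete_gamma l (x * t) * phi t))%R @[x --> 0^'+] --> B.
    rewrite -[X in _ --> X](_ : A * 0 + B + 0 = B)%R; last by rewrite mulr0 add0r addr0.
    apply: cvgD; last exact: gamma_transform_cvg0.
    apply: cvgD; last exact: cvg_cst.
    by apply: cvgM; [exact: cvg_cst|exact: powR_cvg0].
  by apply: cvg_trans cf; apply: near_eq_cvg; near=> x; rewrite fE.
exists A, a; split=> //; last by move=> x x0; rewrite fE'// f0 addrK.
split=> //.
- by move=> t t0; rewrite aE// ltry.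
- apply: (nonincreasing_lty (lexx 0%R) (measurable_tail ma a0)
    (@measurable_gweight _ l 1) _ _ _ _ (Ly 1%R ltr01)).
  + by move=> t; exact: tail_ge0.
  + by move=> t; exact: gweight_ge0.
  + by move=> s t _ st; exact: tail_nonincreasing.
  + by move=> t; exact: gweight_gt0.
- by apply: cm_eq cphi => t t0; rewrite aE.
Unshelve. all: end_near. Qed.

End thorin_bernstein.

Theorem corollary5p3 (R : realType) (lambda1 lambda2 alpha1 alpha2 : R)
    (f1 f2 : R -> R) :
  0 < lambda1 -> 0 < lambda2 ->
  alpha1 < lambda1 + 1 -> alpha2 < lambda2 + 1 ->
  thorin_bernstein lambda1 alpha1 f1 ->
  thorin_bernstein lambda2 alpha2 f2 ->
  thorin_bernstein (lambda1 + lambda2) (alpha1 + alpha2 - 1)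
    (fun x : R => (f1 x - value_at0 f1) * (f2 x - value_at0 f2)).
Proof.
move=> l10 l20 al1 al2.
move=> /(density_of_thorin_bernstein l10)[A1 [a [A10 da La f1E]]].
move=> /(density_of_thorin_bernstein l20)[A2 [b [A20 db Lb f2E]]].
pose pa := product_density (powR_density lambda1) b.
pose pb := product_density (powR_density lambda2) a.
pose c := convolution_density lambda1 lambda2 a b.
have dpa : cm_density (alpha1 + alpha2 - 1) pa.
  exact: cm_density_product (cm_density_powR l10 (ltW al1)) db.
have dpb : cm_density (alpha1 + alpha2 - 1) pb.
  rewrite [alpha1 + _]addrC.
  exact: cm_density_product (cm_density_powR l20 (ltW al2)) da.
have dc : cm_density (alpha1 + alpha2 - 1) c.
  exact: cm_density_convolution da db (La _ ltr01) (Lb _ ltr01).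
have dA1 := cm_densityZ A10 dpa; have dA2 := cm_densityZ A20 dpb.
have [ma a0 _ _ _] := da; have [mb b0 _ _ _] := db.
have [mpa pa0 _ _ _] := dpa; have [mpb pb0 _ _ _] := dpb.
have [mA1 pA10 _ _ _] := dA1; have [mA2 pA20 _ _ _] := dA2.
have d12 := cm_densityD dA1 dA2; have [m12 p120 _ _ _] := d12.
have [mc c0 _ _ _] := dc.
have LE x : (laplace (lambda1 + lambda2)
      (fun t => A1%:E * pa t + A2%:E * pb t + c t) x =
    A1%:E * laplace lambda2 b x + A2%:E * laplace lambda1 a x +
    laplace lambda1 a x * laplace lambda2 b x)%E.
  rewrite (laplaceD (lambda1 + lambda2) x m12 mc p120 c0)
    (laplaceD (lambda1 + lambda2) x mA1 mA2 pA10 pA20).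
  rewrite (laplaceZ (lambda1 + lambda2) x A10 mpa pa0)
    (laplaceZ (lambda1 + lambda2) x A20 mpb pb0).
  rewrite (laplace_powR lambda2 x l10 mb b0)
    (laplace_convolution lambda1 lambda2 ma a0 mb b0 x).
  by rewrite [lambda1 + _]addrC (laplace_powR lambda1 x l20 ma a0).
have fin1 x : 0 < x -> exists L, laplace lambda1 a x = L%:E.
  by move=> x0; exists (fine (laplace lambda1 a x)); rewrite fineK_lty ?laplace_ge0 ?La.
have fin2 x : 0 < x -> exists L, laplace lambda2 b x = L%:E.
  by move=> x0; exists (fine (laplace lambda2 b x)); rewrite fineK_lty ?laplace_ge0 ?Lb.
apply: (thorin_bernstein_of_density (addr_gt0 l10 l20) (mulr_ge0 A10 A20)
  (cm_densityD d12 dc)) => x x0; rewrite LE;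
  have [L1 L1E] := fin1 x x0; have [L2 L2E] := fin2 x x0.
  by rewrite L1E L2E -!EFinM -!EFinD ltry.
rewrite (f1E _ x0) (f2E _ x0) L1E L2E -!EFinM -!EFinD /=.
rewrite powRD; last by rewrite (gt_eqF x0) implybT.
by move: (x `^ lambda1) (x `^ lambda2) => u v; ring.
Qed.
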